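(* Suppose there exist constants $\delta>0$ and $0<\varepsilon<1$ such that $D(\delta|i,a,b)\le 1-\varepsilon$ for all $(i,a,b)\in S\times A\times B$. Given any $p\in\mathcal P(K)$, there exists $\pi^*\in\Pi$ such that for every $i\in S$ $$V(p,i,\pi^*,\sigma)\ge V^*(p,i),\qquad\forall\,\sigma\in\Sigma,$$ i.e. $\pi^*$ is an optimal policy for Player 1 in $G(p)$.
   Context: Model. $K,S,A,B$ are finite nonempty sets (game types, states, actions of Player 1, actions of Player 2). For a finite set $E$, $\mathcal P(E)$ is the set of probability distributions on $E$. $Q(\cdot,\cdot|i,a,b)$ is a semi-Markov kernel on $[0,\infty)\times S$ given $S\times A\times B$: for all $i,j,a,b$, $t\mapsto Q(t,j|i,a,b)$ is nondecreasing, right continuous, nonnegative, with $Q(0,j|i,a,b)=0$; $\sum_{j}Q(t,j|i,a,b)\le 1$ for all $t$; and $\sum_j\lim_{t\to\infty}Q(t,j|i,a,b)=1$. Put $D(t|i,a,b):=\sum_{j\in S}Q(t,j|i,a,b)$. The payoff rate is $c:K\times S\times A\times B\to[0,\infty)$, and $\alpha>0$ is a fixed discount factor. $G(p)$ denotes the game with type distribution $p\in\mathcal P(K)$. Policies. $\mathcal H_n=(S\times A\times B)^n\times S$ is the set of histories $h_n=(i_0,a_0,b_0,\dots,a_{n-1},b_{n-1},i_n)$. $\Pi$ is the set of policies of Player 1, i.e. families $\pi=\{\pi_n^{(k)}:k\in K,n\ge0\}$ of stochastic kernels $\pi_n^{(k)}(\cdot|h_n)\in\mathcal P(A)$, $h_n\in\mathcal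 H_n$. $\Sigma$ is the set of policies of Player 2, i.e. families $\sigma=\{\sigma_n:n\ge0\}$ of stochastic kernels $\sigma_n(\cdot|h_n)\in\mathcal P(B)$. Probability. On $\Omega=K\times(S\times A\times B\times[0,\infty))^\infty$ with product $\sigma$-algebra, for $\omega=(k,i_0,a_0,b_0,t_1,i_1,a_1,b_1,t_2,\dots)$ put $\kappa=k$, $X_n=i_n$, $A_n=a_n$, $B_n=b_n$, $T_0=0$, $T_{n}=\sum_{m=1}^{n}t_m$, $H_n=(X_0,A_0,B_0,\dots,A_{n-1},B_{n-1},X_n)$, $T_\infty=\lim_nT_n$. For $p\in\mathcal P(K)$, $i\in S$, $\pi\in\Pi$, $\sigma\in\Sigma$, $\mathbb P_{p,i}^{\pi,\sigma}$ (expectation $\mathbb E_{p,i}^{\pi,\sigma}$) is the unique probability measure with $\mathbb P(X_0=i,\kappa=k)=p_k$; $\mathbb P(A_n=a,B_n=b|\kappa,H_n,T_n)=\pi_n^{(\kappa)}(a|H_n)\sigma_n(b|H_n)$; $\mathbb P(T_{n+1}-T_n\le t,X_{n+1}=j|\kappa,H_n,T_n,A_n,B_n)=Q(t,j|X_n,A_n,B_n)$. Payoff and value. For $t\in[T_n,T_{n+1})$ the continuous-time processes (written with subscript $t$) take the values $X_n,A_n,B_n$. $V(p,i,\pi,\sigma)=\mathbb E_{p,i}^{\pi,\sigma}\big[\int_0^{T_\infty}e^{-\alpha t}c(\kappa,X_t,A_t,B_t)\,dt\big]$; $\underline V(p,i)=\sup_{\pi\in\Pi}\inf_{\sigma\in\Sigma}V(p,i,\pi,\sigma)$,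 $\overline V(p,i)=\inf_{\sigma\in\Sigma}\sup_{\pi\in\Pi}V(p,i,\pi,\sigma)$. Under the hypothesis of the claim these coincide for all $(p,i)$ and the common value is $V^*(p,i)$. A policy $\pi^*\in\Pi$ is optimal for Player 1 in $G(p)$ if $\inf_{\sigma\in\Sigma}V(p,i,\pi^*,\sigma)\ge\underline V(p,i)$ for all $i\in S$. *)

(* Defs.v *)
From HB Require Import structures.
From mathcomp Require Import all_boot all_order all_algebra.
From mathcomp Require Import all_classical all_reals all_analysis.

Set Implicit Arguments.
Unset Strict Implicit.
Unset Printing Implicit Defensive.

Import Order.TTheory GRing.Theory Num.Theory.
Import numFieldNormedType.Exports.

Local Open Scope classical_set_scope.
Local Open Scope ring_scope.

(* Finite nonempty sets; the distinguished point is used only because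
   measurable spaces are pointed in the library. *)
#[short(type="finPointedType")]
HB.structure Definition FinPointed := {T of Finite T & Pointed T}.

Record fdist (R : realType) (E : finType) := FDist {
  fdist_fun :> E -> R;
  fdist_ge0 : forall x, 0 <= fdist_fun x;
  fdist_sum1 : \sum_x fdist_fun x = 1 }.

Section kernel.
Context {R : realType} {S A B : finType}.
Implicit Type Q : R -> S -> S -> A -> B -> R.

(* [Q t j i a b] is Q(t, j | i, a, b); only its values at t >= 0 matter. *)
Definition semi_markov_kernel Q : Prop :=
  [/\ forall i j a b,
        [/\ forall s t, 0 <= s -> s <= t -> Q s j i a b <= Q t j i a b,
            forall t, 0 <= t -> Q x j i a b @[x --> t^'+] --> Q t j i a b,
            forall t, 0 <= t -> 0 <= Q t j i a b
          & Q 0 j i a b = 0],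
      forall i a b t, 0 <= t -> \sum_j Q t j i a b <= 1
    & forall i a b, \sum_j lim (Q t j i a b @[t --> +oo]) = 1].

Definition sojourn_cdf Q (t : R) (i : S) (a : A) (b : B) : R :=
  \sum_j Q t j i a b.

End kernel.

(* (i_0, a_0, b_0, ..., a_(n-1), b_(n-1), i_n) *)
Definition history (S A B : finType) (n : nat) : Type :=
  (n.-tuple (S * A * B) * S)%type.

Definition policy1 (R : realType) (K S A B : finType) : Type :=
  K -> forall n, history S A B n -> fdist R A.

Definition policy2 (R : realType) (S A B : finType) : Type :=
  forall n, history S A B n -> fdist R B.

HB.instance Definition _ (R : realType) :=
  isPointed.Build (Itv.def (@Itv.num_sem R) (Itv.Real `[0%Z, +oo[)) 0%:nng.

Section trajectories.
Context {R : realType} {K S A B : finPointedType}.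

(* The m-th entry of the sequence is (i_m, a_m, b_m, t_(m+1)). *)
Definition trajectory : Type :=
  (K * (nat -> S * A * B * {nonneg R}))%type.

Implicit Type w : trajectory.

Definition gtype w : K := w.1.
Definition state n w : S := (w.2 n).1.1.1.
Definition act1 n w : A := (w.2 n).1.1.2.
Definition act2 n w : B := (w.2 n).1.2.
Definition holding n w : R := (w.2 n).2%:num.

Definition hist n w : history S A B n :=
  ([tuple (w.2 m).1 | m < n], state n w).

Definition epoch n w : R := \sum_(m < n) holding m w.
Definition epoch_oo w : \bar R := limn (fun n => (epoch n w)%:E).

(* Generators of the product sigma-algebra. *)
Definition coordinate_sets : set (set trajectory) :=
  [set gtype @^-1` U | U in [set: set K]] `|`
  \bigcup_n [set state n @^-1` U | U in [set: set S]] `|`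
  \bigcup_n [set act1 n @^-1` U | U in [set: set A]] `|`
  \bigcup_n [set act2 n @^-1` U | U in [set: set B]] `|`
  \bigcup_n [set holding n @^-1` U | U in @measurable _ R].

End trajectories.
Arguments trajectory : clear implicits.
Arguments coordinate_sets : clear implicits.

Definition Omega (R : realType) (K S A B : finPointedType) : measurableType _ :=
  g_sigma_algebraType (coordinate_sets R K S A B).

Section game.
Context {R : realType} {K S A B : finPointedType}.

Notation Omega := (Omega R K S A B).
Notation policy1 := (policy1 R K S A B).
Notation policy2 := (policy2 R S A B).

(* sigma(kappa, H_n, T_n) *)
Definition sigma_before n : set (set Omega) :=
  <<s [set gtype @^-1` U | U in [set: set K]] `|`
      [set hist n @^-1` U | U in [set: set (history S A B n)]] `|`
      [set epoch n @^-1` U | U in @measurable _ R] >>.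

(* sigma(kappa, H_n, T_n, A_n, B_n) *)
Definition sigma_after n : set (set Omega) :=
  <<s sigma_before n `|`
      [set act1 n @^-1` U | U in [set: set A]] `|`
      [set act2 n @^-1` U | U in [set: set B]] >>.

(* [f] is a version of the conditional probability P(E | F). *)
Definition is_cond_prob (P : probability Omega R) (F : set (set Omega))
    (E : set Omega) (f : Omega -> R) : Prop :=
  (forall U : set R, measurable U -> F (f @^-1` U)) /\
  (forall G, F G -> P (E `&` G) = \int[P]_(w in G) (f w)%:E)%E.

Variable Q : R -> S -> S -> A -> B -> R.

Definition is_law (p : fdist R K) (i : S) (pi : policy1) (sigma : policy2)
    (P : probability Omega R) : Prop :=
  [/\ forall k, P [set w | state 0 w = i /\ gtype w = k] = (p k)%:E,
      forall n a b, is_cond_prob P (sigma_before n)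
        [set w | act1 n w = a /\ act2 n w = b]
        (fun w => pi (gtype w) n (hist n w) a * sigma n (hist n w) b)
    & forall n t j, 0 <= t -> is_cond_prob P (sigma_after n)
        [set w | epoch n.+1 w - epoch n w <= t /\ state n.+1 w = j]
        (fun w => Q t j (state n w) (act1 n w) (act2 n w))].

(* These conditions determine the law of (kappa, H_n, T_n, A_n, B_n, T_(n+1))
   for every n, hence the payoff below does not depend on the choice made. *)
Definition law p i pi sigma : probability Omega R :=
  get [set P | is_law p i pi sigma P].

Variables (c : K -> S -> A -> B -> R) (alpha : R).

(* The n such that T_n <= t < T_(n+1); it exists and is unique when
   0 <= t < T_oo. *)
Definition stage (w : Omega) (t : R) : nat :=
  get [set n | epoch n w <= t < epoch n.+1 w].

Definition payoff_rate (w : Omega) (t : R) : R :=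
  let n := stage w t in c (gtype w) (state n w) (act1 n w) (act2 n w).

Definition discounted_payoff (w : Omega) : \bar R :=
  (\int[lebesgue_measure]_(t in [set t : R | (0 <= t)%R /\ t%:E < epoch_oo w])
     (expR (- (alpha * t)) * payoff_rate w t)%:E)%E.

Definition payoff p i pi sigma : \bar R :=
  (\int[law p i pi sigma]_w discounted_payoff w)%E.

Definition guarantee1 p i (pi : policy1) : \bar R :=
  ereal_inf [set payoff p i pi sigma | sigma in [set: policy2]].

Definition guarantee2 p i (sigma : policy2) : \bar R :=
  ereal_sup [set payoff p i pi sigma | pi in [set: policy1]].

Definition lower_value p i : \bar R :=
  ereal_sup [set guarantee1 p i pi | pi in [set: policy1]].

Definition upper_value p i : \bar R :=
  ereal_inf [set guarantee2 p i sigma | sigma in [set: policy2]].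

Definition is_value p i (v : \bar R) : Prop :=
  lower_value p i = v /\ upper_value p i = v.

Definition optimal1 p (pi : policy1) : Prop :=
  forall i, (lower_value p i <= guarantee1 p i pi)%E.

End game.

(* Main.v *)
Require Import Defs.
From HB Require Import structures.
From mathcomp Require Import all_boot all_order all_algebra.
From mathcomp Require Import all_classical all_reals all_analysis.
From mathcomp Require Import measurable_realfun lra ring.

(** The payoff against a fixed [sigma] is a continuous function of [pi] on the
    compact space of policies (a product of simplices), so [inf_sigma V] is
    upper semicontinuous and attains its supremum: the limit of near-optimal
    policies along an ultrafilter is optimal, and no minimax theorem is needed.
    Continuity holds because [V] is the sum over [n] of the stage payoffs, each
    of which is a polynomial in finitely many values of [pi]: the weights
    [E(e^(-alpha T_n); kappa = k, H_n = h)] satisfy a one-step recursion whose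
    only other ingredient is the Laplace transform of [Q]. The assumption on
    [D] makes the total weight at stage [n] at most [beta ^ n] with [beta < 1],
    so the series converges uniformly in [pi]. Since policies remember the
    initial state, policies that are optimal from each initial state can be
    glued together.

    As [law] is a choice among the measures satisfying [is_law], the existence
    of such a measure has to be proved; it is the image of the uniform law on
    the unit interval, whose binary digits are split into a sequence of
    independent uniform variables that drive the simulation of the game. *)

Set Implicit Arguments.
Unset Strict Implicit.
Unset Printing Implicit Defensive.

Import Order.TTheory GRing.Theory Num.Theory.
Import numFieldNormedType.Exports.

Local Open Scope classical_set_scope.
Local Open Scope ring_scope.

(** * Uniform noise *)

Section uniqueness.
Context {R : realType}.
Local Open Scope ereal_scope.

(** [law] is an opaque choice, so everything about it has to be read off from the three clauses of
    [is_law]. These clauses only speak of conditional probabilities, in which every conditioning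
    variable except T_n is finite-valued. Hence they amount to product formulas for sets of the form
    (discrete event) and {T_n <= t}, and the exponential law turns averages of such probabilities
    over t into discounted expectations. This is how the recursion for the weights is obtained from
    clauses that never mention discounting. The simulation stays on the real line for a similar
    reason: independence of the noises is an identity between distribution functions, which a
    self-similarity argument settles, and no product measure has to be built. In the optimality
    argument only [pi] passes to a limit, with [sigma] fixed, and the limit policy is chosen before
    [sigma]. The order matters: the number of stages is fixed first, then the limit in [pi] is
    taken, then the number of stages grows; the geometric bound, uniform in [pi], is what allows
    this. *)

Lemma measurable_halflines :
  (@measurable _ (measurableTypeR R) : set (set R)) =
  <<s [set A | exists x, A = `]-oo, x]%classic] >>.
Proof.
have -> : @measurable _ (measurableTypeR R) = <<s @RGenOInfty.G R >>.
  exact: RGenOInfty.measurableE.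
rewrite eqEsubset; split; apply: smallest_sub; try exact: smallest_sigma_algebra.
- move=> _ [x ->]; rewrite -setCitvl.
  have [_ sC _] := smallest_sigma_algebra setT
    [set A | exists x : R, A = `]-oo, x]%classic].
  by rewrite -setTD; apply: sC; apply: sub_sigma_algebra; exists x.
- move=> _ [x ->]; rewrite -setCitvr.
  have [_ sC _] := smallest_sigma_algebra setT (@RGenOInfty.G R).
  by rewrite -setTD; apply: sC; apply: sub_sigma_algebra; exists x.
Qed.

Lemma setI_closed_halflines :
  setI_closed [set A | exists x : R, A = `]-oo, x]%classic].
Proof.
move=> _ _ [x ->] [y ->]; exists (Num.min x y).
by apply/seteqP; split => z /=; rewrite !in_itv/= le_min => /andP.
Qed.

(** Dynkin's argument: the sets V that satisfy the product formula form a lambda-system, the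
    hypothesis [P E = r%:E] being the case V = [setT]. It serves both to identify laws on the line
    and, with f the identity, to prove independence from a generated sigma-algebra. *)
Lemma prob_pi_system d d' (T : measurableType d) (T' : measurableType d')
    (P : probability T R) (m : probability T' R) (f : T -> T') (E : set T)
    (r : R) (G : set (set T')) :
  measurable_fun setT f -> measurable E -> setI_closed G ->
  G `<=` measurable -> P E = r%:E ->
  (forall V, G V -> P (E `&` f @^-1` V) = r%:E * m V) ->
  forall V, <<s G >> V -> P (E `&` f @^-1` V) = r%:E * m V.
Proof.
move=> mf mE GI Gm PE H.
have mfV V : measurable V -> measurable (f @^-1` V).
  by move=> mV; rewrite -[X in measurable X]setTI; exact: mf.
suff: <<s G >> `<=` [set V | measurable V /\ P (E `&` f @^-1` V) = r%:E * m V].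
  by move=> + V GV => /(_ V GV)[].
apply: lambda_system_subset => //; last by move=> V GV; split; [exact: Gm|exact: H].
apply/dynkin_lambda_system; split => /=.
- by split=> //; rewrite preimage_setT setIT PE probability_setT mule1.
- move=> A [mA PA]; split; first exact: measurableC.
  have PEoo : P E < +oo by rewrite PE ltry.
  rewrite probability_setC// preimage_setC -setDE measureD//; last exact: mfV.
  rewrite [X in X - _](_ : _ = r%:E); last exact: PE.
  rewrite [X in _ - X](_ : _ = r%:E * m A); last exact: PA.
  by rewrite muleBr ?mule1// fin_num_adde_defr.
- move=> F tF HF; have mF n : measurable (F n) by case: (HF n).
  split; first exact: bigcupT_measurable.
  rewrite preimage_bigcup setI_bigcupr.
  rewrite measure_bigcup//; last 2 first.
  - by move=> n _; apply: measurableI => //; exact: mfV.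
  - apply/trivIsetP => i j _ _ ij; rewrite setIACA setIid -preimage_setI.
    by move/trivIsetP : tF => -> //; rewrite preimage_set0 setI0.
  rewrite [in RHS]measure_bigcup// -nneseriesZl//.
  by apply: eq_eseriesr => n _; case: (HF n).
Qed.

Lemma prob_halflines d (T : measurableType d) (P : probability T R)
    (m : probability (measurableTypeR R) R) (E : set T) (f : T -> R) (r : R) :
  measurable E -> measurable_fun setT f -> P E = r%:E ->
  (forall x, P (E `&` f @^-1` `]-oo, x]) = r%:E * m `]-oo, x]%classic) ->
  forall V, measurable V -> P (E `&` f @^-1` V) = r%:E * m V.
Proof.
move=> mE mf PE H V; have mEq := measurable_halflines; rewrite [measurable]mEq.
apply: (@prob_pi_system _ _ T (measurableTypeR R)) => //.
- exact: setI_closed_halflines.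
- by move=> _ [x ->].
- by move=> _ [x ->].
Qed.

End uniqueness.

Section uniform_noise.
Context {R : realType}.

Definition unif : probability (measurableTypeR R) R := uniform_prob (@ltr01 R).

Lemma unifE (V : set R) : measurable V -> unif V = lebesgue_measure (V `&` `[0, 1]).
Proof.
move=> mV; rewrite /unif/= /uniform_prob integral_uniform_pdf.
rewrite (eq_integral (fun=> 1%E)); last first.
  move=> x; rewrite inE/= in_itv/= => -[_ x01].
  by rewrite /uniform_pdf x01 subr0 invr1.
by rewrite integral_cst ?mul1e//; exact: measurableI.
Qed.

Lemma unif_itvcc x y : 0 <= x -> x <= y -> y <= 1 ->
  unif `[x, y]%classic = (y - x)%:E.
Proof.
move=> x0 xy y1; rewrite unifE// setIidl; last first.
  move=> z; rewrite /= !in_itv/= => /andP[xz zy].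
  by rewrite (le_trans x0)//= (le_trans zy).
rewrite lebesgue_measure_itv/= lte_fin; case: ltP => // yx.
by have -> : x = y by [apply/eqP; rewrite eq_le xy yx]; rewrite subrr.
Qed.

Lemma unif_itvco x y : 0 <= x -> x <= y -> y <= 1 ->
  unif `[x, y[%classic = (y - x)%:E.
Proof.
move=> x0 xy y1; rewrite unifE// setIidl; last first.
  move=> z; rewrite /= !in_itv/= => /andP[xz zy].
  by rewrite (le_trans x0)//= (le_trans (ltW zy)).
rewrite lebesgue_measure_itv/= lte_fin; case: ltP => // yx.
by have -> : x = y by [apply/eqP; rewrite eq_le xy yx]; rewrite subrr.
Qed.

Lemma unif_I01 (V : set R) : measurable V -> unif (V `&` `[0, 1]) = unif V.
Proof.
by move=> mV; rewrite !unifE//; [rewrite -setIA setIid|exact: measurableI].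
Qed.

Lemma unif_I01o (V : set R) : measurable V -> unif (V `&` `[0, 1[) = unif V.
Proof.
move=> mV; apply/eqP; rewrite eq_le; apply/andP; split.
  by apply: le_measure; rewrite ?inE//; exact: measurableI.
rewrite -[leLHS]unif_I01//.
rewrite (_ : V `&` `[0, 1] = V `&` `[0, 1[ `|` V `&` [set 1]); last first.
  rewrite -setIUr; congr (_ `&` _); apply/seteqP; split => x; rewrite /= !in_itv/=.
    by move=> /andP[x0]; rewrite le_eqVlt => /orP[/eqP->|x1]; [right|left; apply/andP].
  by case=> [|->]; [lra|rewrite lexx ler01].
apply: (le_trans (measureU2 _ _ _)) => //; try exact: measurableI.
rewrite -[leRHS]adde0 leeD2l//.
have -> : 0%E = unif `[1, 1]%classic :> \bar R by rewrite unif_itvcc ?subrr.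
rewrite set_itv1; apply: le_measure; rewrite ?inE//; exact: measurableI.
Qed.

Definition clip01 (x : R) : R := Num.max 0 (Num.min 1 x).

Lemma unif_halfline x : unif `]-oo, x]%classic = (clip01 x)%:E.
Proof.
rewrite -unif_I01// /clip01; have [x0|x0] := ltP x 0.
  rewrite min_r ?max_l ?(ltW x0) ?(le_trans (ltW x0))//.
  rewrite (_ : _ `&` _ = set0) ?measure0//.
  by apply/seteqP; split => // z; rewrite /= !in_itv/=; lra.
have [x1|x1] := leP x 1.
  rewrite max_r// -[in RHS](subr0 x) -unif_itvcc//; congr (unif _).
  by apply/seteqP; split => z; rewrite /= !in_itv/=; lra.
rewrite max_r// -[in RHS](subr0 1) -unif_itvcc//; congr (unif _).
by apply/seteqP; split => z; rewrite /= !in_itv/=; lra.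
Qed.

(** The first binary digit of a point of the unit interval; [dbl] then shifts the expansion by one
    digit. *)
Definition half (u : R) : bool := 2^-1 <= u.
Definition dbl (u : R) : R := 2 * u - (half u)%:R.

Lemma measurable_half b : measurable [set u : R | half u = b].
Proof.
rewrite [X in measurable X](_ : _ = if b then `[2^-1, +oo[%classic else `]-oo, 2^-1[%classic).
  by case: b.
apply/seteqP; split => u; case: b; rewrite /= /half in_itv/= ?andbT//.
  by move/negbT; rewrite -ltNge.
by rewrite ltNge => /negbTE.
Qed.

Lemma measurable_fun_half : measurable_fun setT (fun u : R => (half u)%:R : R).
Proof.
rewrite [X in measurable_fun _ X](_ : _ = \1_[set u | half u = true]); last first.
  apply/funext => u; rewrite indicE; congr (_%:R).
  case: (boolP (u \in _)) => [|/negP]; rewrite inE/=; first by move=> ->.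
  by case: (half u).
by apply: measurable_indic; exact: measurable_half.
Qed.

Lemma measurable_dbl : measurable_fun setT (dbl : R -> R).
Proof.
by apply: measurable_funB; [exact: measurable_funM|exact: measurable_fun_half].
Qed.

Lemma unif_half b : unif [set u | half u = b] = (2^-1)%:E.
Proof.
rewrite -unif_I01; last exact: measurable_half.
case: b.
  transitivity (unif `[2^-1, 1]%classic); last by rewrite unif_itvcc; [congr EFin|..]; lra.
  congr (unif _).
  by apply/seteqP; split => u; rewrite /= /half !in_itv/=; lra.
transitivity (unif `[0, 2^-1[%classic); last by rewrite unif_itvco; [congr EFin|..]; lra.
congr (unif _); apply/seteqP; split => u; rewrite /= /half !in_itv/=.
  by case: leP => //; lra.
by move=> h; split; [case: leP; lra|lra].
Qed.

(** The first digit is independent of the remaining ones, whose number is again uniform: on the half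
    with digit b, [dbl u <= x] means [u <= (x + b) / 2], and the affine map doubles lengths. *)
Lemma unif_dbl b (V : set R) : measurable V ->
  unif ([set u | half u = b] `&` dbl @^-1` V) = ((2^-1)%:E * unif V)%E.
Proof.
apply: (@prob_halflines R _ (measurableTypeR R)).
- exact: measurable_half.
- exact: measurable_dbl.
- exact: unif_half.
move=> x; rewrite unif_halfline -EFinM.
have -> : [set u : R | half u = b] `&` dbl @^-1` `]-oo, x] =
   [set u : R | half u = b] `&` `]-oo, (x + b%:R) / 2].
  apply/seteqP; split => u; rewrite /= !in_itv/= /dbl => -[->]; split => //; lra.
rewrite -unif_I01; last by apply: measurableI => //; exact: measurable_half.
rewrite /clip01; case: b => /=.
  have [x0|x0] := ltP x 0.
    rewrite min_r ?max_l ?(ltW x0) ?(le_trans (ltW x0))// mulr0.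
    rewrite (_ : _ `&` _ = set0) ?measure0//.
    by apply/seteqP; split => // z; rewrite /= !in_itv/= /half; lra.
  have [x1|x1] := leP x 1.
    rewrite max_r//; transitivity (unif `[2^-1, (x + 1) / 2]%classic).
      by congr (unif _); apply/seteqP; split => z; rewrite /= !in_itv/= /half; lra.
    by rewrite unif_itvcc; [congr EFin|..]; lra.
  rewrite max_r//; transitivity (unif `[2^-1, 1]%classic).
    by congr (unif _); apply/seteqP; split => z; rewrite /= !in_itv/= /half; lra.
  by rewrite unif_itvcc; [congr EFin|..]; lra.
have h (z : R) : (half z = false) = (z < 2^-1).
  by rewrite /half; case: leP => ?; apply/propext; split.
have [x0|x0] := ltP x 0.
  rewrite min_r ?max_l ?(ltW x0) ?(le_trans (ltW x0))// mulr0.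
  rewrite (_ : _ `&` _ = set0) ?measure0//.
  by apply/seteqP; split => // z; rewrite /= !in_itv/= h; lra.
have [x1|x1] := ltP x 1.
  rewrite max_r//; transitivity (unif `[0, x / 2]%classic).
    by congr (unif _); apply/seteqP; split => z; rewrite /= !in_itv/= h; lra.
  by rewrite unif_itvcc; [congr EFin|..]; lra.
rewrite max_r//; transitivity (unif `[0, 2^-1[%classic).
  by congr (unif _); apply/seteqP; split => z; rewrite /= !in_itv/= h; lra.
by rewrite unif_itvco; [congr EFin|..]; lra.
Qed.

End uniform_noise.

(** * Splitting one uniform variable into two independent ones *)

Section even_bits.
Context {R : realType}.
Local Notation unif := (@unif R).
Local Notation dbl := (@dbl R).

Fixpoint even_bits_approx (n : nat) (u : R) : R :=
  if n is m.+1 then ((half u)%:R + even_bits_approx m (dbl (dbl u))) / 2 else 0.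

Lemma even_bits_approx_ge0 n u : 0 <= even_bits_approx n u.
Proof.
elim: n u => //= n IH u.
by have := IH (dbl (dbl u)); case: (half u); rewrite /=; lra.
Qed.

Lemma even_bits_approx_le1 n u : even_bits_approx n u <= 1.
Proof.
elim: n u => //= n IH u.
by have := IH (dbl (dbl u)); case: (half u); rewrite /=; lra.
Qed.

Lemma even_bits_approx_nd u : nondecreasing_seq (even_bits_approx ^~ u).
Proof.
apply/nondecreasing_seqP => n; elim: n u => [|n IH] u.
  exact: even_bits_approx_ge0.
by have /= := IH (dbl (dbl u)); lra.
Qed.

(* The real number whose binary digits are those of [u] of even rank; the
   digits of odd rank are then [even_bits (dbl u)]. *)
Definition even_bits (u : R) : R := limn (even_bits_approx ^~ u).

Lemma cvg_even_bits u : even_bits_approx ^~ u @ \oo --> even_bits u.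
Proof.
apply: nondecreasing_is_cvgn; first exact: even_bits_approx_nd.
by exists 1 => _ [n _ <-]; exact: even_bits_approx_le1.
Qed.

Lemma even_bits_ge0 u : 0 <= even_bits u.
Proof.
apply: limr_ge; first exact: cvg_even_bits.
by near=> n; exact: even_bits_approx_ge0.
Unshelve. all: by end_near. Qed.

Lemma even_bits_le1 u : even_bits u <= 1.
Proof.
apply: limr_le; first exact: cvg_even_bits.
by near=> n; exact: even_bits_approx_le1.
Unshelve. all: by end_near. Qed.

Lemma even_bitsE u : even_bits u = ((half u)%:R + even_bits (dbl (dbl u))) / 2.
Proof.
rewrite {1}/even_bits; apply/cvg_lim => //.
rewrite -cvg_shiftS/=.
apply: cvgMl; apply: cvgD; first exact: cvg_cst.
exact: cvg_even_bits.
Qed.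

Lemma measurable_even_bits : measurable_fun setT even_bits.
Proof.
apply: (@measurable_fun_cvg _ _ _ _ even_bits_approx); last first.
  by move=> u _; exact: cvg_even_bits.
elim=> [|n IH] /=; first exact: measurable_cst.
apply: measurable_funM => //; apply: measurable_funD.
  exact: measurable_fun_half.
apply: (measurableT_comp IH (g := dbl \o dbl)).
by apply: measurableT_comp; exact: measurable_dbl.
Qed.

Lemma unif_dbl2 b b' (V : set R) : measurable V ->
  unif ([set u | half u = b /\ half (dbl u) = b'] `&` (dbl \o dbl) @^-1` V) =
  ((4^-1)%:E * unif V)%E.
Proof.
move=> mV.
transitivity (unif ([set u | half u = b] `&`
    dbl @^-1` ([set u | half u = b'] `&` dbl @^-1` V))).
  by congr (unif _); apply/seteqP; split => u /=; tauto.
rewrite unif_dbl; last first.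
  apply: measurableI; first exact: measurable_half.
  by rewrite -[X in measurable X]setTI; exact: measurable_dbl.
rewrite unif_dbl// muleA -EFinM; congr (_%:E * _)%E; lra.
Qed.

Lemma measurable_preim (f : R -> R) (V : set R) :
  measurable_fun setT f -> measurable V -> measurable (f @^-1` V).
Proof. by move=> mf mV; rewrite -[X in measurable X]setTI; exact: mf. Qed.

(** Iterating the second hypothesis n times bounds f by 2^-n. This is the uniqueness principle for
    bounded solutions of a self-similarity equation: f will be the difference of two solutions. *)
Lemma halving_eq0 (T : Type) (f : T -> R) : (forall x, `|f x| <= 1) ->
  (forall x, exists y, `|f x| <= 2^-1 * `|f y|) -> forall x, f x = 0.
Proof.
move=> f1 fh x; apply/normr0_eq0/eqP; rewrite eq_le normr_ge0 andbT.
have fn n : forall y, `|f y| <= 2^-1 ^+ n.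
  elim: n => [|n IH] y; first by rewrite expr0.
  have [z fz] := fh y; rewrite exprS (le_trans fz)// ler_wpM2l//.
have hcvg : (fun n => 2^-1 ^+ n : R) @ \oo --> (0 : R).
  by apply: cvg_expr; rewrite ger0_norm; lra.
rewrite -(cvg_lim _ hcvg)//; apply: limr_ge; first by apply/cvg_ex; exists 0.
by near=> n; exact: fn.
Unshelve. all: by end_near. Qed.

(* The joint distribution function of the even and odd bits is determined by
   the self-similarity [G_rec], which the product of the uniform distribution
   functions also satisfies: at most one of the four terms of the difference
   is nonzero, so the difference is halved (even quartered) at each step. *)
Let G (x y : R) : R := fine (unif
  (even_bits @^-1` `]-oo, x] `&` (even_bits \o dbl) @^-1` `]-oo, y])).

Let mG x y : measurable
  (even_bits @^-1` `]-oo, x] `&` (even_bits \o dbl) @^-1` `]-oo, y]).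
Proof.
apply: measurableI; apply: measurable_preim => //.
  exact: measurable_even_bits.
by apply: measurableT_comp; [exact: measurable_even_bits|exact: measurable_dbl].
Qed.

Let GE x y : unif
  (even_bits @^-1` `]-oo, x] `&` (even_bits \o dbl) @^-1` `]-oo, y]) = (G x y)%:E.
Proof. by rewrite /G fineK//; apply: fin_num_measure; exact: mG. Qed.

(** Split according to the first two digits b, b' of u. By [even_bitsE], [even_bits u <= x] becomes
    [even_bits (dbl (dbl u)) <= 2 * x - b], and the odd bits give the same with y and b'; by
    [unif_dbl2] each of the four cases carries the factor 1/4. *)
Let G_rec x y : G x y =
  4^-1 * (G (2 * x) (2 * y) + G (2 * x) (2 * y - 1)
        + G (2 * x - 1) (2 * y) + G (2 * x - 1) (2 * y - 1)).
Proof.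
pose C b b' := [set u : R | half u = b /\ half (dbl u) = b'].
have mC b b' : measurable (C b b').
  rewrite (_ : C b b' = [set u | half u = b] `&` dbl @^-1` [set u | half u = b'])//.
  apply: measurableI; first exact: measurable_half.
  by apply: measurable_preim; [exact: measurable_dbl|exact: measurable_half].
pose D b b' := C b b' `&` (dbl \o dbl) @^-1`
  (even_bits @^-1` `]-oo, 2 * x - b%:R] `&` (even_bits \o dbl) @^-1` `]-oo, 2 * y - b'%:R]).
have PD b b' : unif (D b b') = (4^-1 * G (2 * x - b%:R) (2 * y - b'%:R))%:E.
  by rewrite unif_dbl2// GE EFinM.
have mD b b' : measurable (D b b').
  apply: measurableI => //; apply: measurable_preim => //.
  by apply: measurableT_comp; exact: measurable_dbl.
apply: EFin_inj; rewrite -GE.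
have -> : even_bits @^-1` `]-oo, x] `&` (even_bits \o dbl) @^-1` `]-oo, y] =
    (D false false `|` D false true) `|` (D true false `|` D true true).
  apply/seteqP; split => [u|u].
    rewrite /= !in_itv/= even_bitsE (even_bitsE (dbl u)) /D /C/= !in_itv/=.
    case: (half u) => /=; case: (half (dbl u)) => /= -[ux uy].
    - by right; right; split => //; split; lra.
    - by right; left; split => //; split; lra.
    - by left; right; split => //; split; lra.
    - by left; left; split => //; split; lra.
  rewrite /D /C /= !in_itv/= (even_bitsE u) (even_bitsE (dbl u)).
  by move=> [[]|[]] [[-> ->] /=] [] ? ?; split; lra.
have D0 b1 b1' b2 b2' : (b1, b1') <> (b2, b2') -> D b1 b1' `&` D b2 b2' = set0.
  move=> bb; apply/seteqP; split => // u; rewrite /D /C/=.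
  by move=> [[[h1 h2] _] [[h3 h4] _]]; apply: bb; rewrite -h1 -h2 h3 h4.
have mDU b1 b1' b2 b2' : measurable (D b1 b1' `|` D b2 b2') by exact: measurableU.
have PDU b1 : unif (D b1 false `|` D b1 true) = (unif (D b1 false) + unif (D b1 true))%E.
  by apply: measureU; [exact: mD|exact: mD|exact: D0].
transitivity (unif (D false false `|` D false true) + unif (D true false `|` D true true))%E.
  apply: measureU; [exact: mDU|exact: mDU|].
  by rewrite setIUl !setIUr !D0// !setU0.
rewrite !PDU !PD -!EFinD; congr EFin; rewrite /= !subr0; lra.
Qed.

Let G_bound x y : `|G x y| <= 1.
Proof.
rewrite ger0_norm ?fine_ge0//.
by rewrite -lee_fin -GE; apply: probability_le1; exact: mG.
Qed.

Let G_lt0l x y : x < 0 -> G x y = 0.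
Proof.
move=> x0; rewrite /G (_ : _ `&` _ = set0) ?measure0//.
apply/seteqP; split => // u [] /=; rewrite in_itv/= => h _.
by have := even_bits_ge0 u; lra.
Qed.

Let G_lt0r x y : y < 0 -> G x y = 0.
Proof.
move=> x0; rewrite /G (_ : _ `&` _ = set0) ?measure0//.
apply/seteqP; split => // u [] _ /=; rewrite in_itv/= => h.
by have := even_bits_ge0 (dbl u); lra.
Qed.

Let G_minl x y : G x y = G (Num.min 1 x) y.
Proof.
rewrite /G; congr (fine (unif _)); apply/seteqP; split => u /=;
  rewrite !in_itv/= le_min; have := even_bits_le1 u; first by move=> -> [-> ->].
by move=> _ [/andP[_ ->] ->].
Qed.

Let G_minr x y : G x y = G x (Num.min 1 y).
Proof.
rewrite /G; congr (fine (unif _)); apply/seteqP; split => u /=;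
  rewrite !in_itv/= le_min; have := even_bits_le1 (dbl u); first by move=> -> [-> ->].
by move=> _ [-> /andP[_ ->]].
Qed.

Let G11 : G 1 1 = 1.
Proof.
rewrite /G (_ : _ `&` _ = setT) ?probability_setT//.
apply/seteqP; split => // u _ /=; rewrite !in_itv/=.
by rewrite !even_bits_le1.
Qed.

Let clip_le0 (x : R) : x <= 0 -> clip01 x = 0.
Proof. by move=> x0; rewrite /clip01 min_r ?max_l// (le_trans x0). Qed.

Let clip_id (x : R) : 0 <= x -> x <= 1 -> clip01 x = x.
Proof. by move=> x0 x1; rewrite /clip01 min_r ?max_r. Qed.

Let clip_ge1 (x : R) : 1 <= x -> clip01 x = 1.
Proof. by move=> x1; rewrite /clip01 min_l ?max_r. Qed.

Let clip_rec (x : R) : clip01 x = 2^-1 * (clip01 (2 * x) + clip01 (2 * x - 1)).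
Proof.
have [x0|x0] := leP x 0; first by rewrite !clip_le0; lra.
have [x2|x2] := leP (2 * x) 1.
  by rewrite (@clip_le0 (2 * x - 1)) ?clip_id; lra.
have [x1|x1] := leP x 1; last by rewrite !clip_ge1; lra.
by rewrite (@clip_ge1 (2 * x)) ?clip_id; lra.
Qed.

Let clip_bound (x : R) : 0 <= clip01 x <= 1.
Proof.
have [x0|x0] := leP x 0; first by rewrite clip_le0// lexx ler01.
have [x1|x1] := leP x 1; first by rewrite clip_id ?(ltW x0)// x1.
by rewrite clip_ge1 ?ler01 ?lexx// ltW.
Qed.

Let clip_lt0 (x : R) : x < 0 -> clip01 x = 0.
Proof. by move=> x0; rewrite clip_le0// ltW. Qed.

Let G_ge1l x y : 1 <= x -> G x y = G 1 y.
Proof. by move=> x1; rewrite G_minl min_l. Qed.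

Let G_ge1r x y : 1 <= y -> G x y = G x 1.
Proof. by move=> x1; rewrite G_minr min_l. Qed.

Let G_ge0 x y : 0 <= G x y.
Proof. exact: fine_ge0. Qed.

Let G_le1 x y : G x y <= 1.
Proof. by have := G_bound x y; rewrite ger0_norm. Qed.

(** The marginals come before the joint law because they supply its boundary values. On the line y =
    1 the second arguments 2 and 1 of the recursion both act as 1, so it closes up as the
    one-dimensional recursion [clip_rec]. *)
Let G_marginl x : G x 1 = clip01 x.
Proof.
apply/eqP; rewrite -subr_eq0; apply/eqP.
apply: (@halving_eq0 R (fun x => G x 1 - clip01 x)) => {}x.
  have := G_ge0 x 1; have := G_le1 x 1; have := clip_bound x.
  by rewrite ler_norml; lra.
rewrite G_rec (clip_rec x) (@G_ge1r _ (2 * 1)) ?(@G_ge1r _ (2 * 1)); try lra.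
have -> : 2 * 1 - 1 = 1 :> R by lra.
have [x2|x2] := ltP (2 * x) 1.
  exists (2 * x); rewrite !(@G_lt0l (2 * x - 1)) ?(@clip_lt0 (2 * x - 1)); try lra.
  rewrite -[X in X * `|_|]gtr0_norm ?invr_gt0// -normrM le_eqVlt; apply/orP; left.
  by apply/eqP; congr (`| _ |); lra.
exists (2 * x - 1); rewrite !(@G_ge1l (2 * x)) ?(@clip_ge1 (2 * x)) ?G11; try lra.
rewrite -[X in X * `|_|]gtr0_norm ?invr_gt0// -normrM le_eqVlt; apply/orP; left.
by apply/eqP; congr (`| _ |); lra.
Qed.

Let G_marginr y : G 1 y = clip01 y.
Proof.
apply/eqP; rewrite -subr_eq0; apply/eqP.
apply: (@halving_eq0 R (fun y => G 1 y - clip01 y)) => {}y.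
  have := G_ge0 1 y; have := G_le1 1 y; have := clip_bound y.
  by rewrite ler_norml; lra.
rewrite G_rec (clip_rec y) !(@G_ge1l (2 * 1)); try lra.
have -> : 2 * 1 - 1 = 1 :> R by lra.
have [x2|x2] := ltP (2 * y) 1.
  exists (2 * y); rewrite !(@G_lt0r _ (2 * y - 1)) ?(@clip_lt0 (2 * y - 1)); try lra.
  rewrite -[X in X * `|_|]gtr0_norm ?invr_gt0// -normrM le_eqVlt; apply/orP; left.
  by apply/eqP; congr (`| _ |); lra.
exists (2 * y - 1); rewrite !(@G_ge1r _ (2 * y)) ?(@clip_ge1 (2 * y)) ?G11; try lra.
rewrite -[X in X * `|_|]gtr0_norm ?invr_gt0// -normrM le_eqVlt; apply/orP; left.
by apply/eqP; congr (`| _ |); lra.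
Qed.

Let G_clip x y : G x y = clip01 x * clip01 y.
Proof.
apply/eqP; rewrite -subr_eq0; apply/eqP.
pose f (z : R * R) := G z.1 z.2 - clip01 z.1 * clip01 z.2.
suff f_eq0 : forall z, f z = 0 by exact: (f_eq0 (x, y)).
apply: halving_eq0; move=> [{}x {}y].
  rewrite /f /=.
  have := G_ge0 x y; have := G_le1 x y; have /andP[? ?] := clip_bound x.
  have /andP[? ?] := clip_bound y.
  have : 0 <= clip01 x * clip01 y by exact: mulr_ge0.
  have : clip01 x * clip01 y <= 1 by exact: mulr_ile1.
  by rewrite ler_norml; lra.
(* Off the half-open unit square the marginals decide; comparing 2x and 2y with 1 then singles out
   the point that may still lie inside. *)
have f0 x' y' : (x' < 0) || (1 <= x') || ((y' < 0) || (1 <= y')) ->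
    G x' y' - clip01 x' * clip01 y' = 0.
  move=> /orP[/orP[?|?]|/orP[?|?]].
  - by rewrite G_lt0l// clip_lt0// mul0r subrr.
  - by rewrite G_ge1l// clip_ge1// G_marginr mul1r subrr.
  - by rewrite G_lt0r// (@clip_lt0 y')// mulr0 subrr.
  - by rewrite G_ge1r// (@clip_ge1 y')// G_marginl mulr1 subrr.
have fE : f (x, y) =
    4^-1 * (f (2 * x, 2 * y) + f (2 * x, 2 * y - 1)
        + f (2 * x - 1, 2 * y) + f (2 * x - 1, 2 * y - 1)).
  rewrite /f /= G_rec (clip_rec x) (clip_rec y).
  have -> : 4^-1 = 2^-1 * 2^-1 :> R by lra.
  by ring.
have f0l x' y' : (x' < 0) || (1 <= x') -> f (x', y') = 0.
  by move=> h; rewrite /f f0// h.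
have f0r x' y' : (y' < 0) || (1 <= y') -> f (x', y') = 0.
  by move=> h; rewrite /f f0// h orbT.
have f4 (r : R) : `|4^-1 * r| <= 2^-1 * `|r|.
  by rewrite normrM ler_wpM2r// gtr0_norm ?invr_gt0//; lra.
have [x2|x2] := ltP (2 * x) 1.
  have x21 : (2 * x - 1 < 0) || (1 <= 2 * x - 1) by apply/orP; left; lra.
  rewrite (@f0l _ (2 * y) x21) (@f0l _ (2 * y - 1) x21) !addr0 in fE.
  have [y2|y2] := ltP (2 * y) 1.
    have y21 : (2 * y - 1 < 0) || (1 <= 2 * y - 1) by apply/orP; left; lra.
    exists (2 * x, 2 * y).
    by rewrite fE (@f0r _ _ y21) addr0 f4.
  have y21 : (2 * y < 0) || (1 <= 2 * y) by apply/orP; right.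
  exists (2 * x, 2 * y - 1).
  by rewrite fE (@f0r _ _ y21) add0r f4.
have x21 : (2 * x < 0) || (1 <= 2 * x) by apply/orP; right.
rewrite (@f0l _ (2 * y) x21) (@f0l _ (2 * y - 1) x21) !add0r in fE.
have [y2|y2] := ltP (2 * y) 1.
  have y21 : (2 * y - 1 < 0) || (1 <= 2 * y - 1) by apply/orP; left; lra.
  exists (2 * x - 1, 2 * y).
  by rewrite fE (@f0r _ _ y21) addr0 f4.
have y21 : (2 * y < 0) || (1 <= 2 * y) by apply/orP; right.
exists (2 * x - 1, 2 * y - 1).
by rewrite fE (@f0r _ _ y21) add0r f4.
Qed.

Lemma unif_even_odd_bits (V W : set R) : measurable V -> measurable W ->
  unif (even_bits @^-1` V `&` (even_bits \o dbl) @^-1` W) = (unif V * unif W)%E.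
Proof.
move=> mV mW.
have mb1 := measurable_even_bits.
have mb2 : measurable_fun setT (even_bits \o dbl).
  by apply: measurableT_comp; [exact: measurable_even_bits|exact: measurable_dbl].
have b1E V' : measurable V' -> unif (even_bits @^-1` V') = unif V'.
  move=> mV'; rewrite -[X in unif X = _]setTI -[RHS]mul1e.
  apply: (@prob_halflines R _ (measurableTypeR R)) => // [|x].
    by rewrite probability_setT.
  rewrite mul1e unif_halfline -G_marginl -GE; congr (unif _).
  apply/seteqP; split => [u [_ ux]|u [ux _]]; split => //=.
  by rewrite in_itv/= even_bits_le1.
(* Half-lines are replaced by Borel sets in one coordinate at a time: here the odd bits still range
   over a half-line. *)
have V1 y V' : measurable V' ->
    unif ((even_bits \o dbl) @^-1` `]-oo, y] `&` even_bits @^-1` V') =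
    ((clip01 y)%:E * unif V')%E.
  apply: (@prob_halflines R _ (measurableTypeR R)) => //.
  - exact: measurable_preim.
  - rewrite -G_marginr -GE; congr (unif _).
    apply/seteqP; split => [u ux|u []//]; split => //=.
    by rewrite in_itv/= even_bits_le1.
  - by move=> x; rewrite setIC GE G_clip unif_halfline mulrC EFinM.
have Vfin : unif V \is a fin_num by exact: fin_num_measure.
rewrite -(fineK Vfin).
apply: (@prob_halflines R _ (measurableTypeR R)) => //.
- exact: measurable_preim.
- by rewrite b1E// fineK.
- by move=> x; rewrite setIC V1// unif_halfline fineK// muleC.
Qed.

End even_bits.

(** * A sequence of independent uniform variables *)

Section noise.
Context {R : realType}.
Local Notation unif := (@unif R).

(* Each step uses up the even bits of the seed and keeps the odd ones. *)
Fixpoint noise_seed (n : nat) (u : R) : R :=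
  if n is m.+1 then even_bits (dbl (noise_seed m u)) else u.

Definition noise (n : nat) (u : R) : R := even_bits (noise_seed n u).

(* A pi-system that generates the sigma-algebra of the first [n] noises. *)
Fixpoint past_gen (n : nat) : set (set R) :=
  if n is m.+1 then
    [set G `&` noise m @^-1` V | G in <<s past_gen m >> & V in @measurable _ R]
  else set0.

Definition past n : set (set R) := <<s past_gen n >>.

Lemma past_setI n G H : past n G -> past n H -> past n (G `&` H).
Proof. exact: (@measurableI _ (g_sigma_algebraType (past_gen n))). Qed.

Lemma past_setC n G : past n G -> past n (~` G).
Proof. exact: (@measurableC _ (g_sigma_algebraType (past_gen n))). Qed.

Lemma past_setT n : past n setT.
Proof. exact: (@measurableT _ (g_sigma_algebraType (past_gen n))). Qed.

Lemma past_set0 n : past n set0.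
Proof. exact: (@measurable0 _ (g_sigma_algebraType (past_gen n))). Qed.

Lemma past_bigcup n (F : (set R)^nat) :
  (forall k, past n (F k)) -> past n (\bigcup_k F k).
Proof.
by move=> h; apply: (@bigcupT_measurable _ (g_sigma_algebraType (past_gen n))).
Qed.

Lemma past_bigcup_fin n (I : finType) (F : I -> set R) :
  (forall k, past n (F k)) -> past n (\bigcup_k F k).
Proof.
move=> h; apply: (@fin_bigcup_measurable _ (g_sigma_algebraType (past_gen n))) => //.
by move=> k _; exact: h.
Qed.

Lemma past_subS n : past n `<=` past n.+1.
Proof.
move=> G pG; apply: sub_sigma_algebra => /=; exists G => //.
by exists setT => //; rewrite preimage_setT setIT.
Qed.

Lemma past_mono m n : (m <= n)%N -> past m `<=` past n.
Proof.
move=> /subnK <-; elim: (n - m)%N => [|k IH] //=.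
by apply: subset_trans IH _; exact: past_subS.
Qed.

Lemma past_noise n (V : set R) : measurable V -> past n.+1 (noise n @^-1` V).
Proof.
move=> mV; apply: sub_sigma_algebra => /=; exists setT; first exact: past_setT.
by exists V => //; rewrite setTI.
Qed.

Lemma measurable_noise_seed n : measurable_fun setT (noise_seed n).
Proof.
elim: n => [|n IH] /=; first exact: measurable_id.
apply: (measurableT_comp (f := even_bits \o dbl)) => //.
by apply: measurableT_comp; [exact: measurable_even_bits|exact: measurable_dbl].
Qed.

Lemma measurable_noise n : measurable_fun setT (noise n).
Proof.
by apply: measurableT_comp; [exact: measurable_even_bits|exact: measurable_noise_seed].
Qed.

Lemma past_measurable n : past n `<=` @measurable _ R.
Proof.
elim: n => [|n IH]; apply: smallest_sub => //; try exact: sigma_algebra_measurable.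
move=> _ [G pG [V mV <-]]; apply: measurableI; first exact: IH.
by apply: measurable_preim => //; exact: measurable_noise.
Qed.

Lemma past_gen_setI n : setI_closed (past_gen n).
Proof.
case: n => [|n] //= _ _ [G pG [V mV <-]] [H pH [W mW <-]].
exists (G `&` H); first exact: past_setI.
exists (V `&` W); first exact: measurableI.
by rewrite preimage_setI setIACA.
Qed.

Lemma past_gen_measurable n : past_gen n `<=` @measurable _ R.
Proof. by move=> G h; apply: (@past_measurable n); exact: sub_sigma_algebra. Qed.

(** The induction carries the seed rather than the noise, because the seed contains all future
    noises. The next noise and the next seed are the even and the odd bits of a uniform seed that is
    independent of the past, so [unif_even_odd_bits] moves the noise into the past and leaves a
    fresh uniform seed. *)
Lemma past_indep_seed n (G V : set R) : past n G -> measurable V ->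
  unif (G `&` noise_seed n @^-1` V) = (unif G * unif V)%E.
Proof.
elim: n G V => [|n IH] G V pG mV.
  have Vfin : unif V \is a fin_num by exact: fin_num_measure.
  rewrite setIC muleC -(fineK Vfin).
  apply: (@prob_pi_system R _ _ (measurableTypeR R) (measurableTypeR R)
    unif unif idfun _ _ (past_gen 0)) => //.
  - exact: measurable_id.
  - by rewrite fineK.
have Vfin : unif V \is a fin_num by exact: fin_num_measure.
have mb2 : measurable_fun setT ((@even_bits R) \o dbl).
  by apply: measurableT_comp; [exact: measurable_even_bits|exact: measurable_dbl].
have mW : measurable ((@even_bits R \o dbl) @^-1` V) by exact: measurable_preim.
have UW : unif ((@even_bits R \o dbl) @^-1` V) = unif V.
  have := @unif_even_odd_bits R setT V measurableT mV.
  by rewrite probability_setT mul1e preimage_setT setTI.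
rewrite setIC muleC -(fineK Vfin).
apply: (@prob_pi_system R _ _ (measurableTypeR R) (measurableTypeR R)
    unif unif idfun _ _ (past_gen n.+1)) => //.
- exact: measurable_id.
- by apply: measurable_preim => //; exact: measurable_noise_seed.
- exact: past_gen_setI.
- exact: past_gen_measurable.
- have := IH setT ((@even_bits R \o dbl) @^-1` V) (@past_setT n) mW.
  by rewrite setTI probability_setT mul1e UW fineK.
move=> _ [H pH [W mW' <-]].
have mWW : measurable (@even_bits R @^-1` W).
  by apply: measurable_preim => //; exact: measurable_even_bits.
have UWW : unif (@even_bits R @^-1` W) = unif W.
  have := @unif_even_odd_bits R W setT mW' measurableT.
  by rewrite probability_setT mule1 preimage_setT setIT.
have h1 := IH H (even_bits @^-1` W `&` (@even_bits R \o dbl) @^-1` V) pH (measurableI _ _ mWW mW).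
have h2 := IH H _ pH mWW.
rewrite unif_even_odd_bits// in h1; rewrite UWW in h2.
transitivity (unif (H `&` noise_seed n @^-1`
  (even_bits @^-1` W `&` (@even_bits R \o dbl) @^-1` V))).
  by congr (unif _); apply/seteqP; split => u; rewrite /noise/=; tauto.
rewrite h1 fineK// muleA -h2 muleC; congr (_ * _)%E.
Qed.

Lemma past_indep_noise n (G V : set R) : past n G -> measurable V ->
  unif (G `&` noise n @^-1` V) = (unif G * unif V)%E.
Proof.
move=> pG mV.
have mWW : measurable (@even_bits R @^-1` V).
  by apply: measurable_preim => //; exact: measurable_even_bits.
have -> : noise n @^-1` V = noise_seed n @^-1` (even_bits @^-1` V) by [].
rewrite past_indep_seed//; congr (_ * _)%E.
have := @unif_even_odd_bits R V setT mV measurableT.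
by rewrite probability_setT mule1 preimage_setT setIT.
Qed.

End noise.

(** * Sampling *)

Section sampling.
Context {R : realType} {E : finType}.
Variables (w : E -> R) (e0 : E).

Definition offset (e : E) : R := \sum_(e' | (enum_rank e' < enum_rank e)%N) w e'.

(** Inverse transform sampling: when the weights form a distribution, the half-open intervals of
    length [w e] starting at [offset e] tile [[0, 1[], and the default [e0] only appears outside of
    it. *)
Definition sample (v : R) : E :=
  odflt e0 [pick e | offset e <= v < offset e + w e].

Hypotheses (w_ge0 : forall e, 0 <= w e) (w_sum1 : \sum_e w e = 1).

Let cumul (m : nat) : R := \sum_(e | (enum_rank e < m)%N) w e.

Let cumulS (e : E) : cumul (enum_rank e).+1 = offset e + w e.
Proof.
rewrite /cumul (bigD1 e)//= addrC; congr (_ + _); apply: eq_bigl => e'.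
rewrite ltnS ltn_neqAle andbC; congr (_ && _).
by rewrite (inj_eq (val_inj)) (inj_eq enum_rank_inj).
Qed.

Lemma offset_ge0 e : 0 <= offset e.
Proof. exact: sumr_ge0. Qed.

Let cumul_le1 (P : pred E) : \sum_(e | P e) w e <= 1.
Proof. by rewrite -w_sum1 [leRHS](bigID P)/= lerDl; exact: sumr_ge0. Qed.

Lemma offset_le1 e : offset e + w e <= 1.
Proof. by rewrite -cumulS; exact: cumul_le1. Qed.

Let offset_lt e e' : (enum_rank e < enum_rank e')%N -> offset e + w e <= offset e'.
Proof.
move=> ee'; rewrite -cumulS /cumul /offset.
rewrite [leRHS](bigID (fun e'' => (enum_rank e'' < (enum_rank e).+1)%N))/=.
rewrite -[leLHS]addr0 lerD ?sumr_ge0//.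
rewrite le_eqVlt; apply/orP; left; apply/eqP; apply: eq_bigl => e''.
by rewrite ltnS; apply/idP/andP => [h|[]//]; split => //; exact: leq_ltn_trans ee'.
Qed.

(** The partial sums [cumul] start at 0 and end at 1 > v, so they step over v at some index. *)
Let sample_ex v : 0 <= v < 1 -> exists e, offset e <= v < offset e + w e.
Proof.
move=> /andP[v0 v1].
have [m [mE mv vm]] : exists m, [/\ (m < #|E|)%N, cumul m <= v & v < cumul m.+1].
  apply: contrapT => h.
  have H m : (m <= #|E|)%N -> cumul m <= v.
    elim: m => [|m IH] mE; first by rewrite /cumul big_pred0.
    by rewrite leNgt; apply/negP => vm; apply: h; exists m; split => //; exact/IH/ltnW.
  have := H #|E| (leqnn _); rewrite /cumul.
  under eq_bigl do rewrite ltn_ord.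
  by rewrite w_sum1 leNgt v1.
exists (enum_val (Ordinal mE)); rewrite -cumulS /offset enum_valK/=.
by apply/andP.
Qed.

Let sample_uniq v e e' : offset e <= v < offset e + w e ->
  offset e' <= v < offset e' + w e' -> e = e'.
Proof.
move=> /andP[h1 h2] /andP[h3 h4]; apply: enum_rank_inj; apply: val_inj.
have [h|h|//] := ltngtP (enum_rank e) (enum_rank e').
  by exfalso; have {h} := offset_lt h; move: h1 h2 h3 h4; lra.
by exfalso; have {h} := offset_lt h; move: h1 h2 h3 h4; lra.
Qed.

Lemma sampleP v e : 0 <= v < 1 ->
  sample v = e <-> offset e <= v < offset e + w e.
Proof.
move=> /sample_ex[e' he']; rewrite /sample; case: pickP => [e''/= he''|/(_ e')].
  by split => [<-//|he]; exact: sample_uniq he.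
by rewrite he'.
Qed.

Lemma sample_out v : ~~ (0 <= v < 1) -> sample v = e0.
Proof.
move=> v01; rewrite /sample; case: pickP => //= e he; case/negP: v01.
by have := offset_le1 e; have := offset_ge0 e; lra.
Qed.

Lemma measurable_sample e : measurable [set v | sample v = e].
Proof.
rewrite [X in measurable X](_ : _ = (`[offset e, offset e + w e[ `&` `[0, 1[) `|`
   (if e == e0 then ~` `[0, 1[ else set0)); last first.
  apply/seteqP; split => v /=; rewrite !in_itv/=.
    have [v01|v01] := boolP (0 <= v < 1); first by move/sampleP => -> //; left.
    by rewrite sample_out// => <-; right; rewrite eqxx/= in_itv/=; apply/negP.
  move=> [[h v01]|]; first exact/sampleP.
  case: eqP => // -> /=; rewrite in_itv/= => /negP; exact: sample_out.
apply: measurableU; first exact: measurableI.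
by case: ifP => // _; exact: measurableC.
Qed.

Lemma unif_sample e : unif [set v | sample v = e] = (w e)%:E.
Proof.
rewrite -unif_I01o; last exact: measurable_sample.
rewrite [X in unif X](_ : _ = `[offset e, offset e + w e[%classic); last first.
  apply/seteqP; split => v /=; rewrite !in_itv/=.
    by move=> [/sampleP h] /h.
  move=> h; have v01 : 0 <= v < 1.
    by have := offset_le1 e; have := offset_ge0 e; lra.
  by split => //; apply/sampleP.
rewrite unif_itvco ?offset_ge0 ?lerDl ?offset_le1//.
by rewrite addrC addKr.
Qed.

End sampling.

(** * Joint draw of the holding time and the next state *)

Section sojourn.
Context {R : realType} {S A B : finPointedType}.
Variable Q : R -> S -> S -> A -> B -> R.
Hypothesis Q_kernel : semi_markov_kernel Q.

Lemma kernel_nd i j a b s t : 0 <= s -> s <= t -> Q s j i a b <= Q t j i a b.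
Proof. by case: Q_kernel => /(_ i j a b)[h _ _ _] _ _; exact: h. Qed.

Lemma kernel_ge0 i j a b t : 0 <= t -> 0 <= Q t j i a b.
Proof. by case: Q_kernel => /(_ i j a b)[_ _ h _] _ _; exact: h. Qed.

Lemma kernel_le1 i j a b t : 0 <= t -> Q t j i a b <= 1.
Proof.
move=> t0; case: Q_kernel => _ /(_ i a b t t0) + _; apply: le_trans.
by rewrite (bigD1 j)//= lerDl sumr_ge0// => k _; exact: kernel_ge0.
Qed.

Lemma kernel_right_cts i j a b t : 0 <= t ->
  Q x j i a b @[x --> t^'+] --> Q t j i a b.
Proof. by case: Q_kernel => /(_ i j a b)[_ h _ _] _ _; exact: h. Qed.

Definition jump_prob i a b j := lim (Q t j i a b @[t --> +oo]).

Lemma cvg_kernel i j a b : Q t j i a b @[t --> +oo] --> jump_prob i a b j.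
Proof.
(* The kernel is monotone at nonnegative times only; freezing it before 0 makes it monotone on the
   whole line without changing it near infinity. *)
pose Q' t := Q (Num.max 0 t) j i a b.
have Q'cvg : Q' t @[t --> +oo] --> sup (range Q').
  apply: nondecreasing_cvgr.
    move=> s t st; rewrite /Q'; apply: kernel_nd; first by rewrite le_max lexx.
    by rewrite ge_max !le_max lexx/= st orbT.
  by exists 1 => _ [t _ <-]; apply: kernel_le1; rewrite le_max lexx.
suff : Q t j i a b @[t --> +oo] --> sup (range Q') by move/cvgP.
apply: cvg_trans Q'cvg; apply: near_eq_cvg; near=> t.
by rewrite /Q' max_r//; near: t; exact: nbhs_pinfty_ge.
Unshelve. all: by end_near. Qed.

Lemma kernel_le_jump i j a b t : 0 <= t -> Q t j i a b <= jump_prob i a b j.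
Proof.
move=> t0; apply: (cvgr_to_ge (@cvg_kernel i j a b)); near=> s.
by apply: kernel_nd => //; near: s; exact: nbhs_pinfty_ge.
Unshelve. all: by end_near. Qed.

Lemma jump_prob_ge0 i a b j : 0 <= jump_prob i a b j.
Proof. by apply: le_trans (@kernel_le_jump _ _ _ _ 0 _); [exact: kernel_ge0|]. Qed.

Lemma jump_prob_sum1 i a b : \sum_j jump_prob i a b j = 1.
Proof. by case: Q_kernel => _ _ /(_ i a b). Qed.

Definition sojourn i a b j (x : R) : R := inf [set s | 0 <= s /\ x <= Q s j i a b].

Lemma sojourn_ge0 i a b j x : 0 <= sojourn i a b j x.
Proof.
rewrite /sojourn; set X := [set s | _]; have [->|/set0P X0] := eqVneq X set0.
  by rewrite inf0.
by apply: lb_le_inf => // s [].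
Qed.

(** The Galois connection of a quantile function. Right continuity makes the infimum attained; the
    strict bound on x makes the set nonempty, as otherwise its infimum would be the default 0. *)
Lemma sojourn_le i a b j x s : 0 <= s -> x < jump_prob i a b j ->
  sojourn i a b j x <= s <-> x <= Q s j i a b.
Proof.
move=> s0 xq; split; last first.
  by move=> xQ; apply: ge_inf => //; exists 0 => y [].
have lbX : has_lbound [set s | 0 <= s /\ x <= Q s j i a b] by exists 0 => y [].
have [t [t0 xt]] : exists t, 0 <= t /\ x <= Q t j i a b.
  have := cvgr_gt _ (@cvg_kernel i j a b) _ xq => -[M [Mr hM]].
  exists (`|M| + 1); split; first by rewrite addr_ge0.
  by apply: ltW; apply: hM; rewrite (le_lt_trans (ler_norm M))// ltrDl.
move=> Ts; apply: (cvgr_to_ge (@kernel_right_cts i j a b s s0)).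
near=> y.
have sy : s < y by near: y; exact: nbhs_right_gt.
have ys : 0 < y - s by rewrite subr_gt0.
have hi : has_inf [set s | 0 <= s /\ x <= Q s j i a b] by split => //; exists t.
have [e [e0 xe] ey] := inf_adherent ys hi.
apply: (le_trans xe); apply: kernel_nd => //.
apply: ltW; apply: (lt_le_trans ey); rewrite -/(sojourn i a b j x); lra.
Unshelve. all: by end_near. Qed.

Definition next_state i a b (v : R) : S := sample (jump_prob i a b) point v.

(* [v] is uniform: its position in the partition of the unit interval into
   pieces of length [jump_prob] gives the next state, and the generalized
   inverse of [Q] at its offset in the piece gives the holding time, so that
   the two together have the joint law [Q]. *)
Definition hold_time i a b (v : R) : R :=
  if 0 <= v < 1 then
    let j := next_state i a b v in
    sojourn i a b j (v - offset (jump_prob i a b) j)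
  else 0.

Lemma hold_time_ge0 i a b v : 0 <= hold_time i a b v.
Proof. by rewrite /hold_time; case: ifP => // _; exact: sojourn_ge0. Qed.

Let next_stateP i a b v j : 0 <= v < 1 -> next_state i a b v = j <->
  offset (jump_prob i a b) j <= v < offset (jump_prob i a b) j + jump_prob i a b j.
Proof.
by move=> v01; apply: sampleP => //; [exact: jump_prob_ge0|exact: jump_prob_sum1].
Qed.

(** Inside the piece of j, [sojourn_le] turns a holding time of at most s into
    [v - offset <= Q s j i a b]. Since the kernel never exceeds [jump_prob], the event is an initial
    segment of the piece, of length [Q s j i a b]. *)
Let step_setE i a b j s : 0 <= s ->
  [set v | hold_time i a b v <= s /\ next_state i a b v = j] `&` `[0, 1[ =
  `[offset (jump_prob i a b) j, offset (jump_prob i a b) j + jump_prob i a b j[ `&`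
  `]-oo, offset (jump_prob i a b) j + Q s j i a b].
Proof.
move=> s0; have o0 := @offset_ge0 _ _ _ (@jump_prob_ge0 i a b) j.
have o1 := @offset_le1 _ _ _ (@jump_prob_ge0 i a b) (@jump_prob_sum1 i a b) j.
apply/seteqP; split => v; rewrite /= !in_itv/=.
  move=> [[vs vj] v01]; move: vs; rewrite /hold_time v01 vj.
  move/next_stateP : vj => /(_ v01) => vj.
  by move/sojourn_le => vQ; split => //; have := vQ s0 ltac:(lra); lra.
move=> [vj vs]; have v01 : 0 <= v < 1 by lra.
have vj' : next_state i a b v = j by apply/next_stateP.
by split => //; split => //; rewrite /hold_time v01 vj'; apply/sojourn_le => //; lra.
Qed.

Lemma measurable_next_state i a b j : measurable [set v | next_state i a b v = j].
Proof.
by apply: measurable_sample; [exact: jump_prob_ge0|exact: jump_prob_sum1].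
Qed.

Lemma measurable_hold_time i a b : measurable_fun setT (hold_time i a b).
Proof.
apply: (measurability (@RGenOInfty.G R)) => [|/= _ [_] [s] -> <-].
  exact: RGenOInfty.measurableE.
rewrite setTI -setCitvl preimage_setC; apply: measurableC.
have [s0|s0] := ltP s 0.
  rewrite [X in measurable X](_ : _ = set0)//; apply/seteqP; split => // v /=.
  by rewrite in_itv/=; have := hold_time_ge0 i a b v; lra.
rewrite [X in measurable X](_ : _ = ~` `[0, 1[ `|`
    \bigcup_j ([set v | hold_time i a b v <= s /\ next_state i a b v = j] `&` `[0, 1[)).
  apply: measurableU; first exact: measurableC.
  apply: fin_bigcup_measurable => // j _; rewrite step_setE//.
  exact: measurableI.
apply/seteqP; split => v /=; rewrite !in_itv/=.
  move=> vs; have [v01|v01] := boolP (0 <= v < 1); last by left; exact/negP.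
  by right; exists (next_state i a b v).
by move=> [/negP/negbTE v01|[j _ [[]]]//]; rewrite /hold_time v01.
Qed.

Lemma unif_step i a b j s : 0 <= s ->
  unif [set v | hold_time i a b v <= s /\ next_state i a b v = j] = (Q s j i a b)%:E.
Proof.
move=> s0; have o0 := @offset_ge0 _ _ _ (@jump_prob_ge0 i a b) j.
have o1 := @offset_le1 _ _ _ (@jump_prob_ge0 i a b) (@jump_prob_sum1 i a b) j.
have Q0 := @kernel_ge0 i j a b s s0; have Qq := @kernel_le_jump i j a b s s0.
have q0 := @jump_prob_ge0 i a b j.
rewrite -unif_I01o; last first.
  apply: (@measurableI _ _ (hold_time i a b @^-1` `]-oo, s]) [set v | next_state i a b v = j]).
    by rewrite -[X in measurable X]setTI; exact: measurable_hold_time.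
  exact: measurable_next_state.
(* If the kernel has already reached its limit, the segment is the whole piece, open on the right;
   otherwise it is closed on the right. *)
rewrite step_setE//; have [->|Qlt] := eqVneq (Q s j i a b) (jump_prob i a b j).
  rewrite setIidl; first by rewrite unif_itvco// ?lerDl// addrC addKr.
  by move=> v; rewrite /= !in_itv/=; lra.
rewrite [X in unif X](_ : _ = `[offset (jump_prob i a b) j,
    offset (jump_prob i a b) j + Q s j i a b]%classic); last first.
  have {}Qlt : Q s j i a b < jump_prob i a b j by rewrite lt_neqAle Qlt.
  by apply/seteqP; split => v; rewrite /= !in_itv/=; lra.
by rewrite unif_itvcc//; [congr EFin|..]; lra.
Qed.

End sojourn.

(** * Histories and events *)

Section histories.
Context {S A B : finPointedType}.

Definition history_ext n (h : history S A B n) (a : A) (b : B) (j : S) :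
  history S A B n.+1 := ([tuple of rcons h.1 (h.2, a, b)], j).

Lemma history_ext_surj n (h' : history S A B n.+1) :
  exists h a b j, h' = @history_ext n h a b j.
Proof.
case: h' => -[s ss] j.
case/lastP: s ss => [//|s [[i a] b]] ss.
have sn : size s == n by move: ss; rewrite size_rcons eqSS.
exists (Tuple sn, i), a, b, j; congr pair; exact: val_inj.
Qed.

Lemma history_ext_inj n (h h' : history S A B n) a b j a' b' j' :
  history_ext h a b j = history_ext h' a' b' j' ->
  [/\ h = h', a = a', b = b' & j = j'].
Proof.
case: h h' => [s i] [s' i'] [/= + ->] => /rcons_inj[/val_inj -> -> -> ->].
by [].
Qed.

Lemma history0 (h : history S A B 0) : h = ([tuple], h.2).
Proof. by case: h => s i; rewrite (tuple0 s). Qed.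

End histories.

Section events.
Context {R : realType} {K S A B : finPointedType}.
Local Notation Omega := (Omega R K S A B).
Implicit Type w : Omega.

Lemma hist_ext n w :
  hist n.+1 w = history_ext (hist n w) (act1 n w) (act2 n w) (state n.+1 w).
Proof.
congr pair; apply: eq_from_tnth => m; rewrite tnth_mktuple (tnth_nth (w.2 n).1)/=.
rewrite nth_rcons size_tuple card_ord; have := ltn_ord m; rewrite ltnS leq_eqVlt => /orP[/eqP ->|mn].
  by rewrite ltnn eqxx -!surjective_pairing.
rewrite mn (nth_map (Ordinal mn)) ?size_enum_ord//.
by rewrite nth_enum_ord.
Qed.

Lemma epochS n w : epoch n.+1 w = epoch n w + holding n w.
Proof. by rewrite /epoch big_ord_recr. Qed.

Lemma measurable_gtype (U : set K) : measurable (gtype @^-1` U : set Omega).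
Proof. by apply: sub_sigma_algebra; left; left; left; left; exists U. Qed.

Lemma measurable_state n (U : set S) : measurable (state n @^-1` U : set Omega).
Proof. by apply: sub_sigma_algebra; left; left; left; right; exists n => //; exists U. Qed.

Lemma measurable_act1 n (U : set A) : measurable (act1 n @^-1` U : set Omega).
Proof. by apply: sub_sigma_algebra; left; left; right; exists n => //; exists U. Qed.

Lemma measurable_act2 n (U : set B) : measurable (act2 n @^-1` U : set Omega).
Proof. by apply: sub_sigma_algebra; left; right; exists n => //; exists U. Qed.

Lemma measurable_holding n : measurable_fun setT (holding n : Omega -> R).
Proof.
by move=> _ U mU; rewrite setTI; apply: sub_sigma_algebra; right; exists n => //; exists U.
Qed.

Lemma measurable_epoch n : measurable_fun setT (epoch n : Omega -> R).
Proof. by apply: measurable_sum => m; exact: measurable_holding. Qed.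

Lemma finite_preimage (F : set (set Omega)) (I : finType) (Y : Omega -> I) :
  sigma_algebra setT F -> (forall i, F [set w | Y w = i]) ->
  forall U : set I, F (Y @^-1` U).
Proof.
move=> [F0 _ FU] FY U.
(* [F] is only known to be closed under unions indexed by the naturals, so the finite type is
   enumerated through [pickle]. *)
have -> : Y @^-1` U = \bigcup_k (if unpickle k is Some i then
    (if `[< U i >] then [set w | Y w = i] else set0) else set0).
  apply/seteqP; split => [w Uw|w [k _]].
    by exists (pickle (Y w)) => //; rewrite pickleK ifT//; exact/asboolP.
  by case: unpickle => // i; case: asboolP => // Ui /= Ywi; rewrite /preimage/= Ywi.
apply: FU => k; case: unpickle => // i.
by case: ifP => // _; exact: FY.
Qed.

Lemma measurable_hist1 n (h : history S A B n) :
  measurable ([set w | hist n w = h] : set Omega).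
Proof.
elim: n h => [|n IH] h.
  rewrite (_ : mkset _ = state 0 @^-1` [set h.2]); first exact: measurable_state.
  apply/seteqP; split => w /=; first by move=> <-.
  by move=> h2; rewrite (history0 h) -h2 [LHS]history0.
have [h0 [a [b [j ->]]]] := history_ext_surj h.
rewrite (_ : mkset _ = [set w | hist n w = h0] `&` act1 n @^-1` [set a] `&`
  act2 n @^-1` [set b] `&` state n.+1 @^-1` [set j]).
  by do !apply: measurableI; [exact: IH|exact: measurable_act1|
    exact: measurable_act2|exact: measurable_state].
apply/seteqP; split => w /=; rewrite hist_ext.
  by move=> /history_ext_inj[-> -> -> ->].
by move=> [[[-> ->] ->] ->].
Qed.

Lemma measurable_hist n (U : set (history S A B n)) :
  measurable (hist n @^-1` U : set Omega).
Proof.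
apply: (@finite_preimage measurable) => //; last exact: measurable_hist1.
exact: sigma_algebra_measurable.
Qed.

Lemma sigma_before_measurable n :
  @sigma_before R K S A B n `<=` @measurable _ Omega.
Proof.
apply: smallest_sub; first exact: sigma_algebra_measurable.
move=> _ [[|]|] [U mU <-]; [exact: measurable_gtype|exact: measurable_hist|].
by rewrite -[X in measurable X]setTI; exact: measurable_epoch.
Qed.

Lemma sigma_after_measurable n :
  @sigma_after R K S A B n `<=` @measurable _ Omega.
Proof.
apply: smallest_sub; first exact: sigma_algebra_measurable.
move=> G [[|]|]; first exact: sigma_before_measurable.
  by move=> [U mU <-]; exact: measurable_act1.
by move=> [U mU <-]; exact: measurable_act2.
Qed.

Lemma sigma_before_sigma n : sigma_algebra setT (@sigma_before R K S A B n).
Proof. exact: smallest_sigma_algebra. Qed.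

Lemma sigma_after_sigma n : sigma_algebra setT (@sigma_after R K S A B n).
Proof. exact: smallest_sigma_algebra. Qed.

Lemma sigma_setI (F : set (set Omega)) G H :
  sigma_algebra setT F -> F G -> F H -> F (G `&` H).
Proof.
move=> sF; rewrite -(sigma_algebra_id sF).
exact: (@measurableI _ (g_sigma_algebraType F)).
Qed.

Section discrete_conditioning.
Variables (P : probability Omega R) (I : finType) (Y : Omega -> I).
Hypothesis mY : forall i, measurable [set w | Y w = i].
Local Open Scope ereal_scope.

Lemma integral_discrete (G : set Omega) (g : I -> R) : measurable G ->
  (forall i, (0 <= g i)%R) ->
  \int[P]_(w in G) (g (Y w))%:E = \sum_i (g i)%:E * P (G `&` [set w | Y w = i]).
Proof.
move=> mG g0.
rewrite (eq_integral (fun w => \sum_i (g i * \1_[set w | Y w = i] w)%:E)); last first.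
  move=> w _; rewrite sumEFin; congr EFin.
  rewrite (bigD1 (Y w))//= indicE mem_set// mulr1 big1 ?addr0// => i iY.
  by rewrite indicE memNset ?mulr0//= => /esym/eqP; rewrite (negbTE iY).
rewrite ge0_integral_sum//; last 2 first.
- by move=> i; apply/measurable_EFinP/measurable_funM.
- by move=> i w _; rewrite lee_fin mulr_ge0.
apply: eq_bigr => i _; under eq_integral do rewrite EFinM.
rewrite ge0_integralZl//; last 2 first.
- by apply/measurable_EFinP/measurable_funTS; exact: measurable_indic.
- by rewrite lee_fin.
by rewrite integral_indic// setIC.
Qed.

Lemma measure_discrete (G : set Omega) : measurable G ->
  P G = \sum_i P (G `&` [set w | Y w = i]).
Proof.
move=> mG; have := @integral_discrete G (fun=> 1%R) mG (fun=> ler01).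
rewrite integral_cst// mul1e => ->.
by apply: eq_bigr => i _; rewrite mul1e.
Qed.

Variable F : set (set Omega).
Hypotheses (sF : sigma_algebra setT F) (mF : F `<=` measurable).
Hypothesis FY : forall i, F [set w | Y w = i].

(** A version that factors through a finite-valued [Y] integrates to a finite sum over its values,
    so the defining identity may be checked on each fiber of [Y]. *)
Lemma is_cond_prob_discrete (E : set Omega) (g : I -> R) : measurable E ->
  (forall i, (0 <= g i)%R) ->
  (forall i G, F G -> P (E `&` (G `&` [set w | Y w = i])) =
                      (g i)%:E * P (G `&` [set w | Y w = i])) ->
  is_cond_prob P F E (fun w => g (Y w)).
Proof.
move=> mE g0 H; split.
  move=> U _; rewrite -[_ @^-1` U]/(Y @^-1` (g @^-1` U)).
  exact: (finite_preimage sF FY).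
move=> G FG; have mG := mF FG.
rewrite integral_discrete// measure_discrete; last exact: measurableI.
by apply: eq_bigr => i _; rewrite -H// setIA.
Qed.

(** The converse use: where the version is constant, conditioning is multiplication by that
    constant. This is how the conditional probabilities of [is_law] enter the computation of
    moments. *)
Lemma is_cond_prob_atom (E : set Omega) (f : Omega -> R) (G : set Omega) (r : R) :
  is_cond_prob P F E f -> F G -> (forall w, G w -> f w = r) ->
  P (E `&` G) = r%:E * P G.
Proof.
move=> [_ Hf] FG fr; have mG := mF FG.
rewrite Hf// (eq_integral (fun=> r%:E)) ?integral_cst//.
by move=> w; rewrite inE => /fr ->.
Qed.

End discrete_conditioning.

End events.

(** * Existence of the law *)

Section simulation.
Context {R : realType} {K S A B : finPointedType}.
Local Notation Omega := (Omega R K S A B).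
Variable Q : R -> S -> S -> A -> B -> R.
Hypothesis Q_kernel : semi_markov_kernel Q.
Variables (p : fdist R K) (i0 : S).
Variables (pi : policy1 R K S A B) (sigma : policy2 R S A B).

Definition act_weight n k (h : history S A B n) (e : A * B) : R :=
  pi k h e.1 * sigma h e.2.

Lemma act_weight_ge0 n k (h : history S A B n) e : 0 <= act_weight k h e.
Proof. by rewrite mulr_ge0 ?fdist_ge0. Qed.

Lemma act_weight_sum1 n k (h : history S A B n) : \sum_e act_weight k h e = 1.
Proof.
rewrite -(pair_bigA _ (fun a b => pi k h a * sigma h b))/=.
under eq_bigr do rewrite -mulr_sumr fdist_sum1 mulr1.
by rewrite fdist_sum1.
Qed.

Definition sim_act n k (h : history S A B n) (v : R) : A * B :=
  sample (act_weight k h) (point, point) v.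

(* Noise [0] draws the type, noise [2 n + 1] the actions of stage [n] and
   noise [2 n + 2] its holding time and the next state. *)
Fixpoint sim_hist (k : K) (n : nat) (u : R) : history S A B n :=
  match n with
  | 0 => ([tuple], i0)
  | m.+1 =>
    let h := sim_hist k m u in
    let e := sim_act k h (noise m.*2.+1 u) in
    history_ext h e.1 e.2 (next_state Q h.2 e.1 e.2 (noise m.*2.+2 u))
  end.

Definition sim_type (u : R) : K := sample p point (noise 0 u).

Definition sim_step (n : nat) (u : R) : S * A * B * {nonneg R} :=
  let h := sim_hist (sim_type u) n u in
  let e := sim_act (sim_type u) h (noise n.*2.+1 u) in
  (h.2, e.1, e.2, NngNum (hold_time_ge0 Q h.2 e.1 e.2 (noise n.*2.+2 u))).

Definition sim (u : R) : Omega := (sim_type u, sim_step ^~ u).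

Lemma hist_sim n u : hist n (sim u) = sim_hist (sim_type u) n u.
Proof.
elim: n => [|n IH]; first by rewrite [LHS]history0.
by rewrite hist_ext IH.
Qed.

Let past_pre m n (V : set R) : (n < m)%N -> measurable V -> past m (noise n @^-1` V).
Proof. by move=> nm mV; apply: past_mono nm _ _; exact: past_noise. Qed.

Lemma past_type k : past 1 [set u | sim_type u = k].
Proof.
apply: (@past_noise _ 0 [set v | sample p point v = k]).
by apply: measurable_sample; [exact: fdist_ge0|exact: fdist_sum1].
Qed.

Lemma measurable_sim_act n k (h : history S A B n) e :
  measurable [set v | sim_act k h v = e].
Proof.
by apply: measurable_sample; [exact: act_weight_ge0|exact: act_weight_sum1].
Qed.

(** One noise for the type and two per stage: the history up to stage n depends on noises of index
    at most 2n, which leaves noise 2n + 1 fresh for the actions and noise 2n + 2 for the jump. *)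
Lemma past_hist n k h : past n.*2.+1 [set u | sim_hist k n u = h].
Proof.
elim: n h => [|n IH] h /=.
  have [<-|ih] := pselect (([tuple], i0) = h).
    by rewrite (_ : mkset _ = setT); [exact: past_setT|apply/seteqP; split].
  rewrite (_ : mkset _ = set0); [exact: past_set0|].
  by apply/seteqP; split => // u /ih.
have [h0 [a [b [j ->]]]] := history_ext_surj h.
rewrite (_ : mkset _ = [set u | sim_hist k n u = h0] `&`
  noise n.*2.+1 @^-1` [set v | sim_act k h0 v = (a, b)] `&`
  noise n.*2.+2 @^-1` [set v | next_state Q h0.2 a b v = j]).
  apply: past_setI; first apply: past_setI.
  - by apply: past_mono (IH h0); rewrite doubleS ltnS -addn2 leq_addr.
  - by apply: past_pre; [rewrite doubleS|exact: measurable_sim_act].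
  - by apply: past_pre; [rewrite doubleS|exact: measurable_next_state].
apply/seteqP; split => u /=.
  move=> /history_ext_inj[h1]; rewrite h1 => ea eb; rewrite ea eb => ej.
  by split => //; split => //; rewrite -ea -eb -surjective_pairing.
by move=> [[-> ->]] /= ->.
Qed.

Lemma past_typehist n k h : past n.*2.+1
  [set u | sim_type u = k /\ sim_hist (sim_type u) n u = h].
Proof.
rewrite (_ : mkset _ = [set u | sim_type u = k] `&` [set u | sim_hist k n u = h]).
  by apply: past_setI; [apply: past_mono (past_type k)|exact: past_hist].
by apply/seteqP; split => u /= [->].
Qed.

Lemma past_fin m (I : finType) (Y : R -> I) (U : set I) :
  (forall i, past m [set u | Y u = i]) -> past m (Y @^-1` U).
Proof.
move=> HY; rewrite (_ : _ @^-1` _ =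
    \bigcup_i (if `[< U i >] then [set u | Y u = i] else set0)).
  apply: past_bigcup_fin => i; case: ifP => // _; exact: past_set0.
apply/seteqP; split => [u Uu|u [i _]].
  by exists (Y u) => //; rewrite ifT//; exact/asboolP.
by case: asboolP => // Ui /= Yui; rewrite /preimage/= Yui.
Qed.

Lemma past_acts n k h e : past n.*2.+2
  ([set u | sim_type u = k /\ sim_hist (sim_type u) n u = h] `&`
   [set u | sim_act (sim_type u) (sim_hist (sim_type u) n u) (noise n.*2.+1 u) = e]).
Proof.
rewrite (_ : _ `&` _ = [set u | sim_type u = k /\ sim_hist (sim_type u) n u = h] `&`
   noise n.*2.+1 @^-1` [set v | sim_act k h v = e]).
  apply: past_setI; first exact: past_subS (@past_typehist n k h).
  by apply: past_noise; exact: measurable_sim_act.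
by apply/seteqP; split => u /= [[-> ->]].
Qed.

Let step_key n u : K * history S A B n * (A * B) :=
  (sim_type u, sim_hist (sim_type u) n u,
   sim_act (sim_type u) (sim_hist (sim_type u) n u) (noise n.*2.+1 u)).

Let past_step_key n x : past n.*2.+2 [set u | step_key n u = x].
Proof.
case: x => -[k h] e; have := @past_acts n k h e; congr (past _ _).
by apply/seteqP; split => u; rewrite /= /step_key; [move=> [[-> ->] ->]|move=> [-> -> ->]].
Qed.

Lemma past_holding n (V : set R) : measurable V ->
  past n.*2.+3 ((holding n \o sim) @^-1` V).
Proof.
move=> mV.
rewrite (_ : _ @^-1` V = \bigcup_x ([set u | step_key n u = x] `&`
  noise n.*2.+2 @^-1` (hold_time Q x.1.2.2 x.2.1 x.2.2 @^-1` V))).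
  apply: past_bigcup_fin => x; apply: past_setI.
    exact: past_subS (@past_step_key n x).
  by apply: past_noise; apply: measurable_preim => //; exact: measurable_hold_time.
apply/seteqP; split => u /=; first by move=> h; exists (step_key n u).
by move=> [x _ [<-]].
Qed.

Lemma past_epoch n (V : set R) : measurable V ->
  past n.*2.+1 ((epoch n \o sim) @^-1` V).
Proof.
(* Membership in [past m] is restated as measurability on the type carrying this sigma-algebra, so
   that closure under sums applies. *)
have pm m (f : R -> R) : (forall V : set R, measurable V -> past m (f @^-1` V)) ->
  measurable_fun setT (f : g_sigma_algebraType (@past_gen R m) -> R).
  by move=> h _ U mU; rewrite setTI; exact: h.
suff : measurable_fun setT
    (epoch n \o sim : g_sigma_algebraType (@past_gen R n.*2.+1) -> R).
  by move=> h mV; rewrite -[_ @^-1` _]setTI; exact: h.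
elim: n => [|n IH].
  rewrite (_ : _ \o _ = cst 0); first exact: measurable_cst.
  by apply/funext => u; rewrite /= /epoch big_ord0.
rewrite (_ : _ \o _ = (epoch n \o sim) \+ (holding n \o sim)); last first.
  by apply/funext => u /=; rewrite epochS.
apply: measurable_funD; apply: pm => U mU; rewrite doubleS.
  apply: past_subS; apply: past_subS.
  by rewrite -[_ @^-1` _]setTI; exact: IH.
exact: past_holding.
Qed.

(** All that is conditioned on when the actions of stage n are drawn is determined by noises
    preceding the one that draws them. *)
Lemma pull_before n G : sigma_before n G -> past n.*2.+1 (sim @^-1` G).
Proof.
move: G; suff : sigma_before n `<=` [set G | past n.*2.+1 (sim @^-1` G)] by [].
apply: smallest_sub.
  split => /=; first by rewrite preimage_set0; exact: past_set0.
    by move=> G pG; rewrite setTD preimage_setC; exact: past_setC.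
  by move=> F pF; rewrite preimage_bigcup; exact: past_bigcup.
move=> _ [[|]|] [U mU <-] /=.
- apply: past_mono (_ : past 1 (sim_type @^-1` U)) => //.
  by apply: past_fin => k; exact: past_type.
- rewrite (_ : _ @^-1` _ = (fun u => (sim_type u, sim_hist (sim_type u) n u)) @^-1`
      [set x | U x.2]).
    apply: past_fin => -[k h]; have := @past_typehist n k h; congr (past _ _).
    by apply/seteqP; split => u /=; [move=> [-> ->]|move=> [-> ->]].
  by apply/seteqP; split => u; rewrite /preimage/= hist_sim.
- exact: past_epoch.
Qed.

Lemma pull_after n G : sigma_after n G -> past n.*2.+2 (sim @^-1` G).
Proof.
move: G; suff : sigma_after n `<=` [set G | past n.*2.+2 (sim @^-1` G)] by [].
apply: smallest_sub.
  split => /=; first by rewrite preimage_set0; exact: past_set0.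
    by move=> G pG; rewrite setTD preimage_setC; exact: past_setC.
  by move=> F pF; rewrite preimage_bigcup; exact: past_bigcup.
move=> G [[|]|] /=.
- by move=> /pull_before; exact: past_subS.
- move=> [U _ <-]; rewrite (_ : _ @^-1` _ = step_key n @^-1` [set x | U x.2.1])//.
  by apply: past_fin; exact: past_step_key.
- move=> [U _ <-]; rewrite (_ : _ @^-1` _ = step_key n @^-1` [set x | U x.2.2])//.
  by apply: past_fin; exact: past_step_key.
Qed.

Lemma measurable_sim : measurable_fun setT (sim : measurableTypeR R -> Omega).
Proof.
move=> _ G mG; rewrite setTI; move: G mG.
suff : <<s coordinate_sets R K S A B >> `<=` [set G | measurable (sim @^-1` G)] by [].
apply: smallest_sub.
  split => /=; first by rewrite preimage_set0.
    by move=> G pG; rewrite setTD preimage_setC; exact: measurableC.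
  by move=> F pF; rewrite preimage_bigcup; exact: bigcupT_measurable.
move=> G [[[[|]|]|]|] /=.
- move=> [U mU <-]; apply: (@past_measurable _ 1).
  by apply: past_fin => k; exact: past_type.
- move=> [n _ [U mU <-]]; apply: (@past_measurable _ n.*2.+2).
  rewrite (_ : _ @^-1` _ = step_key n @^-1` [set x | U x.1.2.2])//.
  by apply: past_fin; exact: past_step_key.
- move=> [n _ [U mU <-]]; apply: (@past_measurable _ n.*2.+2).
  rewrite (_ : _ @^-1` _ = step_key n @^-1` [set x | U x.2.1])//.
  by apply: past_fin; exact: past_step_key.
- move=> [n _ [U mU <-]]; apply: (@past_measurable _ n.*2.+2).
  rewrite (_ : _ @^-1` _ = step_key n @^-1` [set x | U x.2.2])//.
  by apply: past_fin; exact: past_step_key.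
- by move=> [n _ [U mU <-]]; apply: (@past_measurable _ n.*2.+3); exact: past_holding.
Qed.

Definition sim_mfun : measurableTypeR R -> Omega := sim.

HB.instance Definition _ := isMeasurableFun.Build _ _ _ _ sim_mfun measurable_sim.

Definition sim_law : probability Omega R := distribution unif sim_mfun.

Let sim_lawE G : sim_law G = unif (sim @^-1` G). Proof. by []. Qed.

(** On a fiber of [Y] the event to be predicted constrains a single fresh noise, while the
    conditioning event pulls back into its past, so independence factors the measure. [Y] retains
    just the data on which the prescribed probability depends. *)
Lemma sim_law_is_law : is_law Q p i0 pi sigma sim_law.
Proof.
split.
- move=> k; rewrite sim_lawE.
  rewrite (_ : _ @^-1` _ = setT `&` noise 0 @^-1` [set v | sample p point v = k]).
    rewrite past_indep_noise; last 2 first.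
    + exact: past_setT.
    + by apply: measurable_sample; [exact: fdist_ge0|exact: fdist_sum1].
    by rewrite probability_setT mul1e unif_sample//; [exact: fdist_ge0|exact: fdist_sum1].
  by rewrite setTI; apply/seteqP; split => u /=; [case|].
- move=> n a b.
  pose Y (w : Omega) := (gtype w, hist n w) : K * history S A B n.
  pose g (x : K * history S A B n) := pi x.1 x.2 a * sigma x.2 b.
  have YE x : [set w : Omega | Y w = x] = gtype @^-1` [set x.1] `&` hist n @^-1` [set x.2].
    by apply/seteqP; split => w; rewrite /Y /=; [move=> <-|case: x => k h /= [-> ->]].
  have BY x : sigma_before n [set w | Y w = x].
    have sn := @sigma_before_sigma R K S A B n.
    rewrite YE; apply: (@sigma_setI R K S A B (@sigma_before R K S A B n)) => //.
      by apply: sub_sigma_algebra; left; left; exists [set x.1].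
    by apply: sub_sigma_algebra; left; right; exists [set x.2].
  have mY x : measurable [set w : Omega | Y w = x] by exact: sigma_before_measurable.
  have mE : measurable [set w : Omega | act1 n w = a /\ act2 n w = b].
    by apply: measurableI; [exact: (measurable_act1 n [set a])|exact: (measurable_act2 n [set b])].
  apply: (@is_cond_prob_discrete R K S A B sim_law _ Y mY _ (@sigma_before_sigma R K S A B n)
    (@sigma_before_measurable R K S A B n) BY _ g mE).
    by move=> x; rewrite mulr_ge0 ?fdist_ge0.
  move=> [k h] G /pull_before pG; rewrite !sim_lawE.
  have pGY : past n.*2.+1 (sim @^-1` (G `&` [set w | Y w = (k, h)])).
    rewrite preimage_setI; apply: past_setI => //.
    by apply: pull_before.
  rewrite preimage_setI setIC.
  transitivity (unif (sim @^-1` (G `&` [set w | Y w = (k, h)]) `&`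
      noise n.*2.+1 @^-1` [set v | sim_act k h v = (a, b)])).
    congr (unif _); apply/seteqP; split => u /=; rewrite /Y /= hist_sim.
      move=> [[Gu [uk uh]] [ea eb]]; split; first by split => //; rewrite uh uk.
      by rewrite -ea -eb /act1 /act2 /= uk -uh -uk -surjective_pairing.
    move=> [[Gu [uk uh]] e]; split; first by split => //; rewrite uh uk.
    by rewrite /act1 /act2 /= uh uk e.
  rewrite past_indep_noise//; last exact: measurable_sim_act.
  rewrite unif_sample; [|exact: act_weight_ge0|exact: act_weight_sum1].
  by rewrite muleC.
- move=> n t j t0.
  pose Y (w : Omega) := (state n w, act1 n w, act2 n w) : S * A * B.
  pose g (x : S * A * B) := Q t j x.1.1 x.1.2 x.2.
  have YE x : [set w : Omega | Y w = x] =
      hist n @^-1` [set h | h.2 = x.1.1] `&` (act1 n @^-1` [set x.1.2] `&` act2 n @^-1` [set x.2]).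
    apply/seteqP; split => w; rewrite /Y /=; first by move=> <-.
    by case: x => -[i a] b /= [<- [-> ->]].
  have BY x : sigma_after n [set w | Y w = x].
    have sn := @sigma_after_sigma R K S A B n.
    rewrite YE; do 2?apply: (@sigma_setI R K S A B (@sigma_after R K S A B n)) => //.
    + apply: sub_sigma_algebra; left; left; apply: sub_sigma_algebra; left; right.
      by exists [set h | h.2 = x.1.1].
    + by apply: sub_sigma_algebra; left; right; exists [set x.1.2].
    + by apply: sub_sigma_algebra; right; exists [set x.2].
  have mY x : measurable [set w : Omega | Y w = x] by exact: sigma_after_measurable.
  have mE : measurable [set w : Omega | epoch n.+1 w - epoch n w <= t /\ state n.+1 w = j].
    apply: (@measurableI _ Omega ((fun w => epoch n.+1 w - epoch n w) @^-1` `]-oo, t])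
      (state n.+1 @^-1` [set j])); last exact: measurable_state.
    rewrite -[X in measurable X]setTI; apply: measurable_funB => //; exact: measurable_epoch.
  apply: (@is_cond_prob_discrete R K S A B sim_law _ Y mY _ (@sigma_after_sigma R K S A B n)
    (@sigma_after_measurable R K S A B n) BY _ g mE).
    by move=> x; exact: kernel_ge0.
  move=> [[i a] b] G /pull_after pG; rewrite !sim_lawE.
  have pGY : past n.*2.+2 (sim @^-1` (G `&` [set w | Y w = (i, a, b)])).
    rewrite preimage_setI; apply: past_setI => //.
    by apply: pull_after.
  rewrite preimage_setI setIC.
  transitivity (unif (sim @^-1` (G `&` [set w | Y w = (i, a, b)]) `&`
      noise n.*2.+2 @^-1` [set v | hold_time Q i a b v <= t /\ next_state Q i a b v = j])).
    congr (unif _); apply/seteqP; split => u /=; rewrite /Y /= epochS addrC addKr.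
      move=> [[Gu yu] [ht st]]; split => //; case: yu => e1 e2 e3.
      by rewrite -e1 -e2 -e3.
    move=> [[Gu yu] [ht st]]; split => //; case: yu => e1 e2 e3.
    by rewrite -e1 -e2 -e3 in ht st.
  rewrite past_indep_noise//; last first.
    apply: (@measurableI _ _ (hold_time Q i a b @^-1` `]-oo, t]) [set v | next_state Q i a b v = j]).
      by apply: measurable_preim => //; exact: measurable_hold_time.
    exact: measurable_next_state.
  by rewrite unif_step// muleC.
Qed.

Lemma law_is_law : is_law Q p i0 pi sigma (law Q p i0 pi sigma).
Proof.
by apply: (@getPex _ [set P | is_law Q p i0 pi sigma P]); exists sim_law; exact: sim_law_is_law.
Qed.

End simulation.

(** * Laplace transforms and moments *)

Section laplace.
Context {R : realType}.
Variable alpha : R.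
Hypothesis alpha_gt0 : 0 < alpha.
Local Open Scope ereal_scope.

Lemma exponential_prob_tail (x : R) : (0 <= x)%R ->
  exponential_prob alpha `[x, +oo[%classic = (expR (- (alpha * x)))%:E.
Proof.
move=> x0.
have mpdf V : measurable V ->
    measurable_fun V (EFin \o exponential_pdf alpha).
  by move=> mV; apply/measurable_EFinP/measurable_funTS; exact: measurable_exponential_pdf.
have Etot := integral_exponential_pdf alpha_gt0.
have El : exponential_prob alpha `]-oo, x[%classic = 1 - (expR (- (alpha * x)))%:E.
  rewrite -mulNr /exponential_prob.
  have -> : \int[lebesgue_measure]_(x0 in `]-oo, x[) (exponential_pdf alpha x0)%:E =
     \int[lebesgue_measure]_(x0 in `[0%R, x]) (exponential_pdf alpha x0)%:E.
    rewrite [RHS](_ : _ = \int[lebesgue_measure]_(x0 in `[0%R, x[) (exponential_pdf alpha x0)%:E); last first.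
      by rewrite integral_itv_bndo_bndc//; exact: mpdf.
    rewrite [LHS]integral_mkcond [RHS]integral_mkcond; apply: eq_integral => t _.
    rewrite !patchE /= !mem_setE !in_itv/=; case: ifPn => tx; case: ifPn => //.
      rewrite andbT => t0; rewrite /exponential_pdf patchE mem_setE in_itv/= andbT (negbTE t0); rewrite /point/=.
      reflexivity.
    by rewrite andbF.
  have [x_gt0|] := ltP 0%R x; first exact: exponential_prob_itv0c.
  move=> xle0; have -> : x = 0%R by apply/eqP; rewrite eq_le x0 xle0.
  by rewrite mulr0 expR0 subee// set_itv1 integral_set1.
have : exponential_prob alpha `]-oo, x[%classic + exponential_prob alpha `[x, +oo[%classic = 1.
  rewrite -Etot /exponential_prob -setCitvl.
  rewrite -ge0_integral_setU//; last 4 first.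
  - exact: measurableC.
  - by rewrite setUv; exact: mpdf.
  - by move=> t _; rewrite lee_fin exponential_pdf_ge0// ltW.
  - by apply/disj_setPCl.
  by rewrite setUv.
rewrite El => /eqP; rewrite -[X in _ == X]/((1 : R)%:E) -EFinB.
case: (exponential_prob _ _) => // r; rewrite -EFinD eqe => /eqP h.
by congr EFin; lra.
Qed.

Definition eprob : probability (measurableTypeR R) R :=
  ltac:(refine (exponential_prob alpha : probability (measurableTypeR R) R);
        exact: alpha_gt0).

Lemma eprob_tail (x : R) : (0 <= x)%R ->
  eprob `[x, +oo[%classic = (expR (- (alpha * x)))%:E.
Proof. exact: exponential_prob_tail. Qed.

(* [expR (- (alpha * x))] is the probability that an exponential variable is
   at least [x]; this replaces Laplace-Stieltjes integrals by the values of
   distribution functions. *)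
Lemma integral_laplace d (T : measurableType d) (P : probability T R)
    (G : set T) (W X : T -> R) : measurable G ->
  measurable_fun setT W -> (forall w, 0 <= W w)%R ->
  measurable_fun setT X -> (forall w, 0 <= X w)%R ->
  \int[P]_(w in G) (W w * expR (- (alpha * X w)))%:E =
  \int[eprob]_t \int[P]_(w in G `&` X @^-1` `]-oo, t]) (W w)%:E.
Proof.
move=> mG mW W0 mX X0.
have mXt t : measurable (X @^-1` `]-oo, t]).
  by rewrite -[X in measurable X]setTI; exact: mX.
pose f (z : T * measurableTypeR R) : \bar R :=
  (W z.1 * \1_G z.1 * (X z.1 <= z.2)%R%:R)%:E.
have f0 z : 0 <= f z by rewrite lee_fin !mulr_ge0.
have mf : measurable_fun setT f.
  apply/measurable_EFinP; apply: measurable_funM.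
    apply: measurable_funM; first exact: measurableT_comp.
    by apply: measurableT_comp => //; exact: measurable_indic.
  rewrite [X in measurable_fun _ X](_ : _ =
      \1_[set z : T * measurableTypeR R | (X z.1 <= z.2)%R]); last first.
    apply/funext => z; rewrite indicE; congr (_%:R).
    by case: leP => h; [rewrite mem_set|rewrite memNset//= leNgt h].
  apply: measurable_indic.
  have : measurable_fun setT (fun z : T * measurableTypeR R => (X z.1 <= z.2)%R).
    by apply: measurable_fun_ler; [exact: measurableT_comp|exact: measurable_snd].
  move=> /(_ measurableT [set true]); rewrite setTI => h.
  rewrite [X in measurable X](_ : _ =
    (fun z : T * measurableTypeR R => (X z.1 <= z.2)%R) @^-1` [set true]); first exact: h.
  by apply/seteqP; split => z /=.
transitivity (\int[P]_w \int[eprob]_t f (w, t)); last first.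
  rewrite (fubini_tonelli f mf f0); apply: eq_integral => t _.
  rewrite [RHS]integral_mkcond; apply: eq_integral => w _.
  rewrite patchE /f/= indicE; case: ifPn.
    by rewrite inE/= in_itv/= => -[Gw Xw]; rewrite mem_set// Xw !mulr1.
  rewrite notin_setE/= in_itv/= => h.
  have [Gw|Gw] := pselect (G w); last by rewrite memNset// mulr0 mul0r.
  rewrite mem_set// mulr1; case: (leP (X w) t) => Xt; last by rewrite mulr0.
  by case: h.
rewrite integral_mkcond; apply: eq_integral => w _.
rewrite patchE /f/=; case: ifPn => Gw; last first.
  by under eq_integral do rewrite indicE (negbTE Gw) mulr0 mul0r; rewrite integral0.
under eq_integral do rewrite indicE Gw mulr1 EFinM.
rewrite ge0_integralZl//; last 2 first.
- apply/measurable_EFinP; rewrite [X in measurable_fun _ X](_ : _ =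
      \1_`[X w, +oo[%classic); first exact: measurable_indic.
  apply/funext => t; rewrite indicE; congr (_%:R).
  by rewrite mem_setE in_itv/= andbT.
- by rewrite lee_fin.
rewrite EFinM; congr (_ * _); rewrite -eprob_tail//.
rewrite -[X in eprob X](setIT) -integral_indic//; apply: eq_integral => t _.
by rewrite indicE mem_setE in_itv/= andbT.
Qed.

End laplace.

(** * One-stage discount factors *)

Section discounted_kernel.
Context {R : realType} {S A B : finPointedType}.
Variable Q : R -> S -> S -> A -> B -> R.
Hypothesis Q_kernel : semi_markov_kernel Q.
Variable alpha : R.
Hypothesis alpha_gt0 : 0 < alpha.
Local Notation eprob := (@eprob R alpha alpha_gt0).

(* The Laplace transform of [Q(dt, j | i, a, b)] at [alpha], after integration
   by parts; [Num.max 0 t] because [Q] is irrelevant at negative times. *)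
Definition disc_kernel j i a b : R :=
  fine (\int[eprob]_t (Q (Num.max 0 t) j i a b)%:E).

Lemma measurable_kernel_max j i a b :
  measurable_fun setT (fun t : R => Q (Num.max 0 t) j i a b).
Proof.
apply: nondecreasing_measurable => // s t st; apply: kernel_nd => //.
  by rewrite le_max lexx.
by rewrite ge_max !le_max lexx/= st orbT.
Qed.

Lemma kernel_max_ge0 j i a b t : 0 <= Q (Num.max 0 t) j i a b.
Proof. by apply: kernel_ge0 => //; rewrite le_max lexx. Qed.

Lemma disc_kernelE j i a b :
  (\int[eprob]_t (Q (Num.max 0 t) j i a b)%:E = (disc_kernel j i a b)%:E)%E.
Proof.
rewrite /disc_kernel fineK// ge0_fin_numE; last first.
  by apply: integral_ge0 => t _; rewrite lee_fin kernel_max_ge0.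
apply: (@le_lt_trans _ _ (\int[eprob]_t 1)%E); last first.
  by rewrite integral_cst// mul1e -ge0_fin_numE// fin_num_measure.
apply: ge0_le_integral => //.
- by move=> t _; rewrite lee_fin kernel_max_ge0.
- by apply/measurable_EFinP; exact: measurable_kernel_max.
- by move=> t _; rewrite lee_fin; apply: kernel_le1 => //; rewrite le_max lexx.
Qed.

Lemma disc_kernel_ge0 j i a b : 0 <= disc_kernel j i a b.
Proof.
apply: fine_ge0; apply: integral_ge0 => t _.
by rewrite lee_fin kernel_max_ge0.
Qed.

Variables (delta epsilon : R).
Hypotheses (delta_gt0 : 0 < delta) (epsilon_gt0 : 0 < epsilon)
  (epsilon_lt1 : epsilon < 1)
  (D_le : forall i a b, sojourn_cdf Q delta i a b <= 1 - epsilon).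

(** Equal to (1 - epsilon) + epsilon e^(-alpha delta): the worst expected discount of a stage, in
    which the holding time is 0 with probability 1 - epsilon and delta otherwise. *)
Definition contraction : R := 1 - epsilon * (1 - expR (- (alpha * delta))).

Lemma contraction_ge0 : 0 <= contraction.
Proof.
have : 0 <= epsilon * expR (- (alpha * delta)) by rewrite mulr_ge0 ?expR_ge0// ltW.
by rewrite /contraction; move: epsilon_lt1; lra.
Qed.

Lemma contraction_lt1 : contraction < 1.
Proof.
have : 0 < epsilon * (1 - expR (- (alpha * delta))).
  by rewrite mulr_gt0// subr_gt0 -expR0 ltr_expR oppr_lt0 mulr_gt0.
by rewrite /contraction; lra.
Qed.

(** The sum is the average of D(t) over an exponential t. By monotonicity D(t) is at most 1 -
    epsilon before delta, it is at most 1 afterwards, and t exceeds delta with probability e^(-alpha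
    delta). *)
Lemma sum_disc_kernel_le i a b : \sum_j disc_kernel j i a b <= contraction.
Proof.
rewrite -lee_fin -sumEFin.
under eq_bigr do rewrite -disc_kernelE.
rewrite -ge0_integral_sum//; last 2 first.
- by move=> j; apply/measurable_EFinP; exact: measurable_kernel_max.
- by move=> j t _; rewrite lee_fin kernel_max_ge0.
apply: (@le_trans _ _ (\int[eprob]_t ((1 - epsilon) + epsilon * \1_`[delta, +oo[ t)%:E)%E).
  apply: ge0_le_integral => //.
  - by move=> t _; apply: sume_ge0 => j _; rewrite lee_fin kernel_max_ge0.
  - apply: emeasurable_sum => j; apply/measurable_EFinP; exact: measurable_kernel_max.
  - apply/measurable_EFinP; apply: measurable_funD => //; apply: measurable_funM => //.
  - move=> t _; rewrite sumEFin lee_fin indicE mem_setE in_itv/= andbT.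
    have [dt|td] := leP delta t.
      rewrite mulr1 subrK; case: Q_kernel => _ h _; apply: h.
      by rewrite le_max lexx.
    rewrite mulr0 addr0; apply: le_trans (D_le i a b); apply: ler_sum => j _.
    apply: kernel_nd => //; first by rewrite le_max lexx.
    by rewrite ge_max (ltW td) ltW.
under eq_integral do rewrite EFinD EFinM.
rewrite ge0_integralD//=; last 3 first.
- by move=> t _; rewrite lee_fin subr_ge0 ltW.
- by move=> t _; rewrite -EFinM lee_fin mulr_ge0// ltW.
- by under eq_fun do rewrite -EFinM; apply/measurable_EFinP; apply: measurable_funM.
have e1 : eprob setT = 1%E by exact: probability_setT.
rewrite [X in (X + _)%E](_ : _ = (1 - epsilon)%:E); last first.
  by rewrite integral_cst// -[RHS]mule1; congr (_ * _)%E; exact: e1.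
rewrite ge0_integralZl//; last 2 first.
- by apply/measurable_EFinP.
- by rewrite lee_fin ltW.
rewrite integral_indic// setIT.
rewrite [X in (_ + _ * X)%E](_ : _ = (expR (- (alpha * delta)))%:E); last first.
  exact: (eprob_tail alpha_gt0 (ltW delta_gt0)).
by rewrite -EFinM -EFinD lee_fin /contraction; lra.
Qed.

End discounted_kernel.

(** * The recursion for the discounted weights *)

Section moments.
Context {R : realType} {K S A B : finPointedType}.
Local Notation Omega := (Omega R K S A B).
Variable Q : R -> S -> S -> A -> B -> R.
Hypothesis Q_kernel : semi_markov_kernel Q.
Variable alpha : R.
Hypothesis alpha_gt0 : 0 < alpha.
Local Notation eprob := (@eprob R alpha alpha_gt0).
Variables (p : fdist R K) (i0 : S).
Variables (pi : policy1 R K S A B) (sigma : policy2 R S A B).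
Variable P : probability Omega R.
Hypothesis P_law : is_law Q p i0 pi sigma P.

Definition disc n (w : Omega) : R := expR (- (alpha * epoch n w)).

Definition atom n k (h : history S A B n) : set Omega :=
  [set w | gtype w = k /\ hist n w = h].

Definition acted n k (h : history S A B n) a b : set Omega :=
  [set w | act1 n w = a /\ act2 n w = b] `&` atom k h.

Definition mass n k (h : history S A B n) : R :=
  fine (\int[P]_(w in atom k h) (disc n w)%:E).

Lemma holding_ge0 n (w : Omega) : 0 <= holding n w.
Proof. by rewrite /holding. Qed.

Lemma epoch_ge0 n (w : Omega) : 0 <= epoch n w.
Proof. by apply: sumr_ge0 => m _; exact: holding_ge0. Qed.

Lemma disc_ge0 n w : 0 <= disc n w. Proof. exact: expR_ge0. Qed.

Lemma disc_le1 n w : disc n w <= 1.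
Proof. by rewrite /disc -expR0 ler_expR oppr_le0 mulr_ge0 ?epoch_ge0// ltW. Qed.

Lemma discS n w : disc n.+1 w = disc n w * expR (- (alpha * holding n w)).
Proof. by rewrite /disc epochS -expRD; congr expR; lra. Qed.

Lemma measurable_disc n : measurable_fun setT (disc n).
Proof.
apply: measurableT_comp; first exact: measurable_expR.
apply: measurableT_comp => //; apply: measurable_funM => //; exact: measurable_epoch.
Qed.

Lemma measurable_atom n k (h : history S A B n) : measurable (atom k h).
Proof.
by apply: measurableI; [exact: (measurable_gtype [set k])|exact: (@measurable_hist _ _ _ _ _ n [set h])].
Qed.

Lemma measurable_acted n k (h : history S A B n) a b : measurable (acted k h a b).
Proof.
apply: measurableI; last exact: measurable_atom.
by apply: measurableI; [exact: (measurable_act1 n [set a])|exact: (measurable_act2 n [set b])].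
Qed.

Let sigma_before_atom n k (h : history S A B n) : sigma_before n (atom k h).
Proof.
apply: (@sigma_setI R K S A B (@sigma_before R K S A B n)).
- exact: sigma_before_sigma.
- by apply: sub_sigma_algebra; left; left; exists [set k].
- by apply: sub_sigma_algebra; left; right; exists [set h].
Qed.

Let sigma_before_epoch n t : sigma_before n [set w : Omega | epoch n w <= t].
Proof.
apply: sub_sigma_algebra; right; exists `]-oo, t]%classic => //.
Qed.

Let sigma_after_acted n k (h : history S A B n) a b : sigma_after n (acted k h a b).
Proof.
have sn := @sigma_after_sigma R K S A B n.
apply: (@sigma_setI R K S A B (@sigma_after R K S A B n)) => //.
- apply: (@sigma_setI R K S A B (@sigma_after R K S A B n)) => //.
  + by apply: sub_sigma_algebra; left; right; exists [set a].
  + by apply: sub_sigma_algebra; right; exists [set b].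
- by apply: sub_sigma_algebra; left; left; exact: sigma_before_atom.
Qed.

Local Open Scope ereal_scope.

(** A discounted integral over G is the average of P(G, T_n <= t) over an exponential t, so a
    proportionality valid for every t passes to it. Applied to the actions and then to the jump of
    stage n. *)
Lemma integral_disc_scaled n (E G : set Omega) (r : R) :
  measurable E -> measurable G -> (0 <= r)%R ->
  (forall t, P (E `&` (G `&` [set w | (epoch n w <= t)%R])) =
             r%:E * P (G `&` [set w | (epoch n w <= t)%R])) ->
  \int[P]_(w in E `&` G) (disc n w)%:E = r%:E * \int[P]_(w in G) (disc n w)%:E.
Proof.
move=> mE mG r0 H.
have me : measurable_fun setT (epoch n : Omega -> R) by exact: measurable_epoch.
have mT t : measurable [set w : Omega | (epoch n w <= t)%R].
  by apply: (@sigma_before_measurable R K S A B n); exact: sigma_before_epoch.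
have L G' : measurable G' -> \int[P]_(w in G') (disc n w)%:E =
    \int[eprob]_t P (G' `&` [set w | (epoch n w <= t)%R]).
  move=> mG'; transitivity (\int[P]_(w in G') (1 * expR (- (alpha * epoch n w)))%:E).
    by apply: eq_integral => w _; rewrite mul1r.
  rewrite (@integral_laplace R alpha alpha_gt0 _ _ P G' (fun=> 1%R) (epoch n))//; last first.
    exact: epoch_ge0.
  apply: eq_integral => t _.
  have -> : epoch n @^-1` `]-oo, t] = [set w : Omega | (epoch n w <= t)%R].
    by apply/seteqP; split => w /=; rewrite in_itv.
  rewrite integral_cst ?mul1e//.
  exact: measurableI.
rewrite L; last exact: measurableI.
rewrite L// -ge0_integralZl//; first by apply: eq_integral => t _; rewrite -setIA.
rewrite (_ : (fun t => _) = EFin \o (fun t => fine (P (G `&` [set w | (epoch n w <= t)%R])))); last first.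
  apply/funext => t /=; rewrite fineK//; apply: fin_num_measure; exact: measurableI.
apply/measurable_EFinP; apply: nondecreasing_measurable => // s t st.
apply: fine_le; try by apply: fin_num_measure; exact: measurableI.
apply: le_measure; rewrite ?inE; try exact: measurableI.
by move=> w [Gw /= h]; split => //=; exact: le_trans st.
Qed.

Lemma integral_disc_fin n (G : set Omega) : measurable G ->
  \int[P]_(w in G) (disc n w)%:E \is a fin_num.
Proof.
move=> mG; rewrite ge0_fin_numE; last first.
  by apply: integral_ge0 => w _; rewrite lee_fin disc_ge0.
apply: (@le_lt_trans _ _ (\int[P]_(w in G) 1)); last first.
  by rewrite integral_cst// mul1e -ge0_fin_numE// fin_num_measure.
apply: ge0_le_integral => //.
- by move=> w _; rewrite lee_fin disc_ge0.
- by apply/measurable_EFinP/measurable_funTS; exact: measurable_disc.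
- by move=> w _; rewrite lee_fin disc_le1.
Qed.

Lemma massE n k (h : history S A B n) :
  \int[P]_(w in atom k h) (disc n w)%:E = (mass k h)%:E.
Proof. by rewrite /mass fineK//; apply: integral_disc_fin; exact: measurable_atom. Qed.

Lemma mass_ge0 n k (h : history S A B n) : (0 <= mass k h)%R.
Proof. by apply: fine_ge0; apply: integral_ge0 => w _; rewrite lee_fin disc_ge0. Qed.

Lemma integral_acted n k (h : history S A B n) a b :
  \int[P]_(w in acted k h a b) (disc n w)%:E =
  (pi k h a * sigma h b * mass k h)%:E.
Proof.
rewrite EFinM -massE; apply: integral_disc_scaled.
- by apply: measurableI; [exact: (measurable_act1 n [set a])|exact: (measurable_act2 n [set b])].
- exact: measurable_atom.
- by rewrite mulr_ge0 ?fdist_ge0.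
move=> t; case: P_law => _ + _ => /(_ n a b) Hab.
apply: (@is_cond_prob_atom R K S A B P _ (@sigma_before_measurable R K S A B n) _ _ _ _ Hab).
- apply: (@sigma_setI R K S A B (@sigma_before R K S A B n)).
  + exact: sigma_before_sigma.
  + exact: sigma_before_atom.
  + exact: sigma_before_epoch.
- by move=> w [[-> ->]].
Qed.

Let jump n t j : set Omega :=
  [set w | (epoch n.+1 w - epoch n w <= t)%R /\ state n.+1 w = j].

Let measurable_jump n t j : measurable (jump n t j).
Proof.
apply: (@measurableI _ Omega ((fun w => (epoch n.+1 w - epoch n w)%R) @^-1` `]-oo, t])
      (state n.+1 @^-1` [set j])); last exact: measurable_state.
rewrite -[X in measurable X]setTI; apply: measurable_funB => //; exact: measurable_epoch.
Qed.

Lemma integral_jump n k (h : history S A B n) a b t j : (0 <= t)%R ->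
  \int[P]_(w in jump n t j `&` acted k h a b) (disc n w)%:E =
  (Q t j h.2 a b)%:E * \int[P]_(w in acted k h a b) (disc n w)%:E.
Proof.
move=> t0; apply: integral_disc_scaled.
- exact: measurable_jump.
- exact: measurable_acted.
- exact: kernel_ge0.
move=> s; case: P_law => _ _ /(_ n t j t0) Hj.
apply: (@is_cond_prob_atom R K S A B P _ (@sigma_after_measurable R K S A B n) _ _ _ _ Hj).
- apply: (@sigma_setI R K S A B (@sigma_after R K S A B n)).
  + exact: sigma_after_sigma.
  + exact: sigma_after_acted.
  + by apply: sub_sigma_algebra; left; left; exact: sigma_before_epoch.
- by move=> w [[[-> ->] [_ <-]]].
Qed.

(** The discount up to T_(n+1) factors into that up to T_n and that of the holding time. Only the
    second factor is expanded by [integral_laplace]; the first stays as the weight W, and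
    [integral_jump] evaluates the integrand at each t. *)
Lemma integral_next n k (h : history S A B n) a b j :
  \int[P]_(w in [set w : Omega | state n.+1 w = j] `&` acted k h a b) (disc n.+1 w)%:E =
  (disc_kernel Q alpha_gt0 j h.2 a b * (pi k h a * sigma h b * mass k h))%:E.
Proof.
have mG : measurable ([set w : Omega | state n.+1 w = j] `&` acted k h a b).
  by apply: measurableI; [exact: (measurable_state n.+1 [set j])|exact: measurable_acted].
under eq_integral do rewrite discS.
rewrite (@integral_laplace R alpha alpha_gt0 _ _ P _ (disc n) (holding n))//; last 4 first.
- exact: measurable_disc.
- exact: disc_ge0.
- exact: measurable_holding.
- exact: holding_ge0.
transitivity (\int[eprob]_t ((Q (Num.max 0 t) j h.2 a b)%:E *
    (pi k h a * sigma h b * mass k h)%:E)).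
  apply: eq_integral => t _; rewrite -integral_acted.
  have [t0|t0] := leP 0%R t.
    rewrite -integral_jump//; congr (integral _ _ _); apply/seteqP; split => w /=.
      by rewrite in_itv/= /jump/= epochS addrC addKr => -[[? ?] ?].
    by rewrite in_itv/= /jump/= epochS addrC addKr => -[[? ?] ?].
  (* For negative t both sides vanish: the truncated kernel is evaluated at 0, and no holding time
     is at most t. *)
  rewrite (_ : Q 0%R j h.2 a b = 0%R); last by case: Q_kernel => /(_ h.2 j a b)[].
  rewrite mul0e (_ : _ `&` _ = set0) ?integral_set0//.
  apply/seteqP; split => // w [_ /=]; rewrite in_itv/= => wt.
  by have := holding_ge0 n w; rewrite leNgt (le_lt_trans wt).
rewrite ge0_integralZr//.
- by rewrite EFinM disc_kernelE.
- by apply/measurable_EFinP; exact: measurable_kernel_max.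
- by move=> t _; rewrite lee_fin kernel_max_ge0.
- by rewrite lee_fin !mulr_ge0 ?fdist_ge0 ?mass_ge0.
Qed.

Lemma massS n k (h : history S A B n) a b j :
  mass k (history_ext h a b j) =
  (disc_kernel Q alpha_gt0 j h.2 a b * (pi k h a * sigma h b * mass k h))%R.
Proof.
apply: EFin_inj; rewrite -massE -integral_next; congr (integral _ _ _).
apply/seteqP; split => w; rewrite /atom /acted /=.
  by move=> [gk]; rewrite hist_ext => /history_ext_inj[? ? ? ?].
by move=> [? [[? ?] [? ?]]]; rewrite hist_ext; split => //; congr history_ext.
Qed.

(** [is_law] only prescribes probabilities of starting at [i0]; since they sum to 1 over the types,
    every other initial state is null. *)
Lemma mass0 k (h : history S A B 0) : mass k h = (if h.2 == i0 then p k else 0)%R.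
Proof.
apply: EFin_inj; rewrite -massE.
have matom := measurable_atom k h.
transitivity (P (atom k h)).
  rewrite (eq_integral (fun=> 1)) ?integral_cst ?mul1e// => w _.
  by rewrite /disc /epoch big_ord0 mulr0 oppr0 expR0.
have atomE : atom k h = [set w | state 0 w = h.2 /\ gtype w = k].
  apply/seteqP; split => w /= [h1 h2]; split => //; first by rewrite -h2.
  by rewrite (history0 h) -h1 [LHS]history0.
case: P_law => Hp _ _; rewrite atomE; case: eqP => [->|hi0]; first exact: Hp.
have mk k' : measurable ([set w | gtype w = k'] : set Omega) by exact: (measurable_gtype [set k']).
have mi : measurable ([set w | state 0 w = i0] : set Omega) by exact: (measurable_state 0 [set i0]).
have P1 : P [set w | state 0 w = i0] = 1.
  rewrite (measure_discrete P mk mi).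
  transitivity (\sum_k (p k)%:E); first by apply: eq_bigr => k' _; exact: Hp.
  by rewrite sumEFin fdist_sum1.
apply/eqP; rewrite eq_le measure_ge0 andbT.
apply: (@le_trans _ _ (P (~` [set w | state 0 w = i0]))).
  apply: le_measure; rewrite ?inE//; first by rewrite -atomE.
    exact: measurableC.
  by move=> w /= [wh _] wi; apply: hi0; rewrite -wh.
by rewrite probability_setC// P1 subee.
Qed.

End moments.

(** * Payoff series *)

Section discounted_payoff.
Context {R : realType} {K S A B : finPointedType}.
Local Notation Omega := (Omega R K S A B).
Variables (c : K -> S -> A -> B -> R) (alpha : R).
Hypotheses (c_ge0 : forall k i a b, 0 <= c k i a b) (alpha_gt0 : 0 < alpha).

Lemma epoch_nd (w : Omega) m n : (m <= n)%N -> epoch m w <= epoch n w.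
Proof.
move=> /subnK <-; elim: (n - m)%N => [|k IH] //.
by rewrite addSn epochS (le_trans IH)// lerDl holding_ge0.
Qed.

Lemma stageE (w : Omega) n t : epoch n w <= t < epoch n.+1 w -> stage w t = n.
Proof.
move=> nt; have := @getPex _ [set n | epoch n w <= t < epoch n.+1 w] (ex_intro _ n nt).
rewrite -/(stage w t) /= => st; have [h|h|//] := ltngtP (stage w t) n.
- by exfalso; have {h} := epoch_nd w h; move: st nt; lra.
- by exfalso; have {h} := epoch_nd w h; move: st nt; lra.
Qed.

Lemma payoff_domain (w : Omega) :
  [set t : R | (0 <= t)%R /\ (t%:E < epoch_oo w)%E] =
  \bigcup_n `[epoch n w, epoch n.+1 w[%classic.
Proof.
have cvgE : (epoch n w)%:E @[n --> \oo] --> ereal_sup (range (fun n => (epoch n w)%:E)).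
  by apply: ereal_nondecreasing_cvgn => m n mn; rewrite lee_fin epoch_nd.
have ooE : epoch_oo w = ereal_sup (range (fun n => (epoch n w)%:E)).
  by rewrite /epoch_oo; apply/cvg_lim.
apply/seteqP; split => t /=.
  move=> [t0]; rewrite ooE => /ereal_sup_gt[_ [n _ <-]]; rewrite lte_fin => tn.
  (* The stage of t is the predecessor of the least n with t < T_n; the value n = 0 is excluded by
     T_0 = 0 <= t. *)
  have ex : exists n, t < epoch n w by exists n.
  case: (ex_minnP ex) => -[|m] mt mmin; first by move: mt; rewrite /epoch big_ord0; lra.
  exists m => //=; rewrite in_itv/= mt andbT leNgt; apply/negP => /mmin.
  by rewrite ltnn.
move=> [n _]; rewrite /= in_itv/= => /andP[nt tn]; split.
  exact: le_trans (epoch_ge0 n w) nt.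
rewrite ooE; apply: (@lt_le_trans _ _ (epoch n.+1 w)%:E); first by rewrite lte_fin.
by apply: ereal_sup_ubound; exists n.+1.
Qed.

(** The integrand is [r / alpha] times the exponential density, so the integral is a difference of
    two exponential tails. *)
Lemma integral_exp_itv (a b r : R) : 0 <= a -> a <= b -> 0 <= r ->
  (\int[lebesgue_measure]_(t in `[a, b[) (expR (- (alpha * t)) * r)%:E =
  (r / alpha * (expR (- (alpha * a)) - expR (- (alpha * b))))%:E)%E.
Proof.
move=> a0 ab r0; have b0 := le_trans a0 ab.
have ran0 : 0 <= r / alpha by rewrite divr_ge0// ltW.
have mpdf V : measurable V ->
    measurable_fun V (EFin \o exponential_pdf alpha).
  by move=> mV; apply/measurable_EFinP/measurable_funTS; exact: measurable_exponential_pdf.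
transitivity ((r / alpha)%:E * exponential_prob alpha `[a, b[%classic)%E.
  rewrite /exponential_prob -ge0_integralZl//; last 2 first.
  - exact: mpdf.
  - by move=> t _; rewrite lee_fin exponential_pdf_ge0// ltW.
  apply: eq_integral => t; rewrite inE/= in_itv/= => /andP[at_ tb].
  rewrite exponential_pdfE ?(le_trans a0)// -EFinM; congr EFin.
  by rewrite mulNr; field; rewrite gt_eqF.
have -> : exponential_prob alpha `[a, b[%classic =
    (expR (- (alpha * a)) - expR (- (alpha * b)))%:E; last by rewrite EFinM.
rewrite EFinB -!exponential_prob_tail//.
have tailE : exponential_prob alpha `[a, +oo[%classic =
    (exponential_prob alpha `[a, b[%classic + exponential_prob alpha `[b, +oo[%classic)%E.
  rewrite /exponential_prob -ge0_integral_setU//.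
  - congr (integral _ _ _); apply/seteqP; split => t; rewrite /= !in_itv/= !andbT.
      by move=> at_; have [bt|tb] := leP b t; [right|left; rewrite at_].
    by move=> [/andP[]//|]; exact: le_trans.
  - by apply: mpdf; exact: measurableU.
  - by move=> t _; rewrite lee_fin exponential_pdf_ge0// ltW.
  - apply/disj_setPS => t [] /=; rewrite !in_itv/= !andbT => /andP[_ tb] bt.
    by move: tb; rewrite ltNge bt.
rewrite tailE !exponential_prob_tail// addeK//.
Qed.

Definition stage_payoff n (w : Omega) : R :=
  c (gtype w) (state n w) (act1 n w) (act2 n w) / alpha *
  (disc alpha n w - disc alpha n.+1 w).

Lemma disc_nd n (w : Omega) : disc alpha n.+1 w <= disc alpha n w.
Proof.
by rewrite /disc ler_expR lerN2 ler_wpM2l ?(ltW alpha_gt0)// epoch_nd.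
Qed.

Lemma stage_payoff_ge0 n w : 0 <= stage_payoff n w.
Proof. by rewrite mulr_ge0 ?subr_ge0 ?disc_nd// divr_ge0// ltW. Qed.

Lemma discounted_payoffE (w : Omega) :
  discounted_payoff c alpha w = (\sum_(n <oo) (stage_payoff n w)%:E)%E.
Proof.
rewrite /discounted_payoff payoff_domain.
have piece n t : `[epoch n w, epoch n.+1 w[%classic t ->
    (expR (- (alpha * t)) * payoff_rate c w t)%:E =
    (expR (- (alpha * t)) * c (gtype w) (state n w) (act1 n w) (act2 n w))%:E.
  by rewrite /= in_itv/= => nt; rewrite /payoff_rate (stageE nt).
rewrite ge0_integral_bigcup//.
- apply: eq_eseriesr => n _.
  transitivity (\int[lebesgue_measure]_(t in `[epoch n w, epoch n.+1 w[)
      (expR (- (alpha * t)) * c (gtype w) (state n w) (act1 n w) (act2 n w))%:E)%E.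
    by apply: eq_integral => t; rewrite inE => /piece.
  by apply: integral_exp_itv => //; [exact: epoch_ge0|exact: epoch_nd].
- apply/measurable_fun_bigcup => // n.
  apply: (eq_measurable_fun (fun t => (expR (- (alpha * t)) * c (gtype w) (state n w) (act1 n w) (act2 n w))%:E)).
    by move=> t; rewrite inE => /piece.
  apply/measurable_EFinP/measurable_funTS; apply: measurable_funM => //.
  apply: measurableT_comp; first exact: measurable_expR.
  by apply: measurableT_comp => //; exact: measurable_funM.
- by move=> t _; rewrite lee_fin /payoff_rate/= mulr_ge0 ?expR_ge0.
- apply/trivIsetP => m n _ _ mn; apply/seteqP; split => // t [] /=.
  rewrite !in_itv/= => /stageE tm /stageE tn.
  by move: mn; rewrite -tm -tn eqxx.
Qed.

Lemma measurable_stage_payoff n :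
  measurable_fun setT (stage_payoff n).
Proof.
apply: measurable_funM; last by apply: measurable_funB; exact: measurable_disc.
apply: measurable_funM => //.
pose Y (w : Omega) := (gtype w, state n w, act1 n w, act2 n w).
rewrite (_ : (fun w => _) = (fun x : K * S * A * B => c x.1.1.1 x.1.1.2 x.1.2 x.2) \o Y)//.
move=> _ U mU; rewrite setTI comp_preimage.
apply: (@finite_preimage R K S A B measurable) => [|x]; first exact: sigma_algebra_measurable.
rewrite (_ : mkset _ = gtype @^-1` [set x.1.1.1] `&` state n @^-1` [set x.1.1.2] `&`
   act1 n @^-1` [set x.1.2] `&` act2 n @^-1` [set x.2]).
  by do !apply: measurableI; [exact: measurable_gtype|exact: measurable_state|
    exact: measurable_act1|exact: measurable_act2].
by apply/seteqP; split => w; rewrite /Y/=; [move=> <-|case: x => -[[k i] a] b /= [[[-> ->] ->] ->]].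
Qed.

End discounted_payoff.

Section payoff_series.
Context {R : realType} {K S A B : finPointedType}.
Local Notation Omega := (Omega R K S A B).
Variable Q : R -> S -> S -> A -> B -> R.
Hypothesis Q_kernel : semi_markov_kernel Q.
Variables (c : K -> S -> A -> B -> R) (alpha : R).
Hypotheses (c_ge0 : forall k i a b, 0 <= c k i a b) (alpha_gt0 : 0 < alpha).
Variables (p : fdist R K) (i0 : S).
Variables (pi : policy1 R K S A B) (sigma : policy2 R S A B).

Lemma integral_partition (P : probability Omega R) (I : finType) (Y : Omega -> I)
    (f : Omega -> R) (G : set Omega) : measurable G ->
  (forall i, measurable [set w | Y w = i]) ->
  measurable_fun setT f -> (forall w, 0 <= f w) ->
  (\int[P]_(w in G) (f w)%:E = \sum_i \int[P]_(w in [set w | Y w = i] `&` G) (f w)%:E)%E.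
Proof.
move=> mG mY mf f0.
rewrite (eq_integral (fun w => \sum_i (f w * \1_[set w | Y w = i] w)%:E)%E); last first.
  move=> w _; rewrite sumEFin; congr EFin.
  rewrite (bigD1 (Y w))//= indicE mem_set// mulr1 big1 ?addr0// => i iY.
  by rewrite indicE memNset ?mulr0//= => /esym/eqP; rewrite (negbTE iY).
rewrite ge0_integral_sum//; last 2 first.
- move=> i; apply/measurable_EFinP/measurable_funTS.
  by apply: measurable_funM => //; exact: measurable_indic.
- by move=> i w _; rewrite lee_fin mulr_ge0.
apply: eq_bigr => i _; rewrite [LHS]integral_mkcond [RHS]integral_mkcond.
apply: eq_integral => w _; rewrite !patchE in_setI indicE.
by case: (w \in G); case: (w \in [set _ | _]); rewrite ?mulr1 ?mulr0.
Qed.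

Let P := law Q p i0 pi sigma.
Let P_law : is_law Q p i0 pi sigma P := law_is_law Q_kernel p i0 pi sigma.

(** The expected payoff of one stage, discounted to the beginning of that stage. *)
Definition gain k i a b : R :=
  c k i a b / alpha * (1 - \sum_j disc_kernel Q alpha_gt0 j i a b).

(** By [integral_acted], the expectation of e^(-alpha T_n) on the event that type, history and
    actions of stage n are given by x. *)
Definition weight n (x : K * history S A B n * A * B) : R :=
  pi x.1.1.1 x.1.1.2 x.1.2 * sigma x.1.1.2 x.2 * mass alpha P x.1.1.1 x.1.1.2.

Let Y n (w : Omega) : K * history S A B n * A * B :=
  (gtype w, hist n w, act1 n w, act2 n w).

Let YE n x : [set w | Y n w = x] = acted x.1.1.1 x.1.1.2 x.1.2 x.2.
Proof.
apply/seteqP; split => w; rewrite /Y /acted /atom /=; first by move=> <-.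
by case: x => -[[k h] a] b /= [[-> ->] [-> ->]].
Qed.

Let mY n x : measurable [set w | Y n w = x].
Proof. by rewrite YE; exact: measurable_acted. Qed.

Let integral_disc n x :
  (\int[P]_(w in [set w | Y n w = x]) (disc alpha n w)%:E = (weight x)%:E)%E.
Proof. by rewrite YE (integral_acted alpha_gt0 P_law). Qed.

Let integral_discS n (x : K * history S A B n * A * B) :
  (\int[P]_(w in [set w | Y n w = x]) (disc alpha n.+1 w)%:E =
   (\sum_j disc_kernel Q alpha_gt0 j x.1.1.2.2 x.1.2 x.2 * weight x)%:E)%E.
Proof.
rewrite (@integral_partition P _ (state n.+1))//.
- rewrite -sumEFin; apply: eq_bigr => j _; rewrite YE.
  by rewrite (integral_next Q_kernel alpha_gt0 P_law).
- by move=> j; exact: (measurable_state n.+1 [set j]).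
- exact: measurable_disc.
- by move=> w; exact: disc_ge0.
Qed.

Lemma integral_stage_payoff n :
  (\int[P]_w (stage_payoff c alpha n w)%:E =
   (\sum_(x : K * history S A B n * A * B) weight x * gain x.1.1.1 x.1.1.2.2 x.1.2 x.2)%:E)%E.
Proof.
rewrite (@integral_partition P _ (@Y n))//; last 3 first.
- exact: mY.
- exact: measurable_stage_payoff.
- exact: stage_payoff_ge0.
rewrite -sumEFin; apply: eq_bigr => x _; rewrite setIT.
have md m : measurable_fun [set w | Y n w = x] (EFin \o disc alpha m : Omega -> \bar R).
  by apply/measurable_EFinP/measurable_funTS; exact: measurable_disc.
have diffE : (\int[P]_(w in [set w | Y n w = x]) (disc alpha n w - disc alpha n.+1 w)%:E =
    ((1 - \sum_j disc_kernel Q alpha_gt0 j x.1.1.2.2 x.1.2 x.2) * weight x)%:E)%E.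
  (* Nonnegative integrals add without integrability conditions; the integral of the difference is
     recovered by subtracting afterwards. *)
  have : (\int[P]_(w in [set w | Y n w = x]) ((disc alpha n w - disc alpha n.+1 w)%:E +
      (disc alpha n.+1 w)%:E) = (weight x)%:E)%E.
    rewrite -integral_disc; apply: eq_integral => w _.
    by rewrite -EFinD subrK.
  rewrite ge0_integralD//=; last 4 first.
  - by move=> w _; rewrite lee_fin subr_ge0 disc_nd.
  - by apply/measurable_EFinP/measurable_funTS; apply: measurable_funB; exact: measurable_disc.
  - by move=> w _; rewrite lee_fin disc_ge0.
  - exact: md.
  rewrite integral_discS -mulr_suml; case: (integral _ _ _) => //= r.
  by rewrite -EFinD => -[h]; congr EFin; lra.
rewrite (eq_integral (fun w => (c x.1.1.1 x.1.1.2.2 x.1.2 x.2 / alpha)%:E *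
    (disc alpha n w - disc alpha n.+1 w)%:E)%E); last first.
  by move=> w; rewrite inE => -/= <-; rewrite -EFinM.
rewrite ge0_integralZl//; last 3 first.
- by apply/measurable_EFinP/measurable_funTS; apply: measurable_funB; exact: measurable_disc.
- by move=> w _; rewrite lee_fin subr_ge0 disc_nd.
- by rewrite lee_fin divr_ge0// ltW.
  by rewrite diffE -EFinM /gain; congr EFin; lra.
exact: mY.
Qed.

(** From here on the law enters the payoff only through [mass], which [mass0] and [massS] determine,
    so comparing or passing to the limit in policies becomes algebra with real numbers. *)
Lemma payoffE : payoff Q c alpha p i0 pi sigma =
  (\sum_(n <oo) (\sum_(x : K * history S A B n * A * B)
     weight x * gain x.1.1.1 x.1.1.2.2 x.1.2 x.2)%:E)%E.
Proof.
rewrite /payoff -/P.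
under eq_integral do rewrite discounted_payoffE//.
rewrite integral_nneseries//.
- by apply: eq_eseriesr => n _; exact: integral_stage_payoff.
- by move=> n; apply/measurable_EFinP; exact: measurable_stage_payoff.
- by move=> n w _; rewrite lee_fin stage_payoff_ge0.
Qed.

Lemma weight_ge0 n (x : K * history S A B n * A * B) : 0 <= weight x.
Proof. by rewrite !mulr_ge0 ?fdist_ge0 ?mass_ge0. Qed.

Variables (delta epsilon : R).
Hypotheses (delta_gt0 : 0 < delta) (epsilon_gt0 : 0 < epsilon)
  (epsilon_lt1 : epsilon < 1)
  (D_le : forall i a b, sojourn_cdf Q delta i a b <= 1 - epsilon).

(** The sum is the expectation of e^(-alpha T_n). In the induction step the expectation for T_(n+1)
    is split by the data of stage n, which exposes the factor [\sum_j disc_kernel]. *)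
Lemma sum_weight_le n :
  \sum_(x : K * history S A B n * A * B) weight x <= contraction alpha delta epsilon ^+ n.
Proof.
have totE m : (\int[P]_w (disc alpha m w)%:E =
    (\sum_(x : K * history S A B m * A * B) weight x)%:E)%E.
  rewrite (@integral_partition P _ (@Y m))//; last 3 first.
- exact: mY.
  - exact: measurable_disc.
  - by move=> w; exact: disc_ge0.
  by rewrite -sumEFin; apply: eq_bigr => x _; rewrite setIT integral_disc.
elim: n => [|n IH].
  rewrite expr0 -lee_fin -totE (eq_integral (fun=> 1%E)).
    by rewrite integral_cst// mul1e; exact: probability_le1.
  by move=> w _; rewrite /disc /epoch big_ord0 mulr0 oppr0 expR0.
rewrite exprS; apply: (@le_trans _ _ (contraction alpha delta epsilon *
    \sum_(x : K * history S A B n * A * B) weight x)); last first.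
  by rewrite ler_wpM2l//; apply: contraction_ge0.
rewrite -lee_fin -totE (@integral_partition P _ (@Y n))//; last 3 first.
- exact: mY.
- exact: measurable_disc.
- by move=> w; exact: disc_ge0.
under eq_bigr do rewrite setIT integral_discS.
rewrite sumEFin lee_fin mulr_sumr; apply: ler_sum => x _.
rewrite -mulr_suml ler_wpM2r ?weight_ge0//.
exact: (sum_disc_kernel_le Q_kernel alpha_gt0 delta_gt0 epsilon_gt0 epsilon_lt1 D_le).
Qed.

End payoff_series.

(** * Optimal policies *)

Section first_state.
Context {S A B : finPointedType}.

(** At n = 0 no stage has been completed, and the default of [head] supplies the initial state. *)
Definition first_state n (h : history S A B n) : S :=
  head h.2 [seq x.1.1 | x <- h.1].

Lemma first_state0 (h : history S A B 0) : first_state h = h.2.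
Proof. by rewrite (history0 h). Qed.

Lemma first_state_ext n (h : history S A B n) a b j :
  first_state (history_ext h a b j) = first_state h.
Proof. by case: h => -[s sn] i; case: s sn. Qed.

End first_state.

Section ultralimit.
Context {R : realType}.

(** The image of an ultrafilter is an ultrafilter, and on the compact unit interval it converges.
    One and the same F makes all coordinates of a policy converge at once. *)
Lemma ultra_cvg01 (T : Type) (F : set_system T) (f : T -> R) :
  UltraFilter F -> (forall x, 0 <= f x <= 1) -> cvg (f @ F).
Proof.
move=> FU f01.
have fU : UltraFilter (f @ F).
  split; first exact: fmap_proper_filter.
  move=> G GP FG; rewrite eqEsubset; split => // A GA.
  have [//|FA] := in_ultra_setVsetC (f @^-1` A) FU.
  have : G (~` A) by apply: FG.
  by move=> /(filterI GA); rewrite setICr => /filter_not_empty.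
have := @segment_compact R 0 1; rewrite compact_ultra => /(_ (f @ F) fU).
have f01F : F (f @^-1` `[0, 1]) by apply: filterE => x; rewrite /= in_itv/=.
by case/(_ f01F) => l [_ fl]; apply/cvg_ex; exists l.
Qed.

Lemma cvg_sum (T : Type) (F : set_system T) (I : Type) (r : seq I)
    (f : I -> T -> R) (l : I -> R) : Filter F ->
  (forall i, f i @ F --> l i) ->
  (fun x => \sum_(i <- r) f i x) @ F --> \sum_(i <- r) l i.
Proof.
move=> FF fl; elim: r => [|i r IH].
  by rewrite big_nil; under eq_fun do rewrite big_nil; exact: cvg_cst.
by rewrite big_cons; under eq_fun do rewrite big_cons; exact: cvgD.
Qed.

End ultralimit.

Section optimality.
Context {R : realType} {K S A B : finPointedType}.
Local Notation policy1 := (policy1 R K S A B).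
Local Notation policy2 := (policy2 R S A B).
Variable Q : R -> S -> S -> A -> B -> R.
Hypothesis Q_kernel : semi_markov_kernel Q.
Variables (c : K -> S -> A -> B -> R) (alpha : R).
Hypotheses (c_ge0 : forall k i a b, 0 <= c k i a b) (alpha_gt0 : 0 < alpha).
Variables (delta epsilon : R).
Hypotheses (delta_gt0 : 0 < delta) (epsilon_gt0 : 0 < epsilon)
  (epsilon_lt1 : epsilon < 1)
  (D_le : forall i a b, sojourn_cdf Q delta i a b <= 1 - epsilon).
Variable p : fdist R K.
Local Notation gain := (gain Q c alpha_gt0).
Local Notation weight := (weight Q alpha p).
Local Notation beta := (contraction alpha delta epsilon).
Let mass_law i (pi : policy1) (sigma : policy2) n k (h : history S A B n) :=
  mass alpha (law Q p i pi sigma) k h.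

Definition partial_payoff i (pi : policy1) (sigma : policy2) N : R :=
  \sum_(n < N) \sum_(x : K * history S A B n * A * B)
     weight i pi sigma x * gain x.1.1.1 x.1.1.2.2 x.1.2 x.2.

Definition gain_bound : R :=
  (\sum_k \sum_i \sum_a \sum_b c k i a b) / alpha.

Lemma gain_ge0 k i a b : 0 <= gain k i a b.
Proof.
rewrite mulr_ge0// ?divr_ge0 ?(ltW alpha_gt0)// subr_ge0.
apply: le_trans (ltW (contraction_lt1 alpha_gt0 delta_gt0 epsilon_gt0)).
exact: (sum_disc_kernel_le Q_kernel alpha_gt0 delta_gt0 epsilon_gt0 epsilon_lt1 D_le).
Qed.

Lemma gain_le k i a b : gain k i a b <= gain_bound.
Proof.
apply: (@le_trans _ _ (c k i a b / alpha)).
  rewrite ler_piMr ?divr_ge0 ?(ltW alpha_gt0)// lerBlDr lerDl.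
  by apply: sumr_ge0 => j _; exact: disc_kernel_ge0.
rewrite ler_pM2r ?invr_gt0//.
rewrite (bigD1 k)//= (bigD1 i)//= (bigD1 a)//= (bigD1 b)//= -!addrA lerDl.
by rewrite !addr_ge0// ?sumr_ge0// => *; rewrite ?sumr_ge0// => *; rewrite ?sumr_ge0// => *; rewrite ?sumr_ge0.
Qed.

Lemma gain_bound_ge0 : 0 <= gain_bound.
Proof.
by rewrite divr_ge0 ?(ltW alpha_gt0)//; do !apply: sumr_ge0 => *.
Qed.

Let beta_ge0 : 0 <= beta. Proof. exact: contraction_ge0. Qed.
Let beta_lt1 : beta < 1. Proof. exact: contraction_lt1. Qed.

(** Times [beta ^+ N], this is the sum of [gain_bound * beta ^+ n] over n >= N. *)
Definition tail_bound : R := gain_bound / (1 - beta).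

Let stage i pi sigma n : R := \sum_(x : K * history S A B n * A * B)
     weight i pi sigma x * gain x.1.1.1 x.1.1.2.2 x.1.2 x.2.

Let stage_ge0 i pi sigma n : 0 <= stage i pi sigma n.
Proof. by apply: sumr_ge0 => x _; rewrite mulr_ge0 ?weight_ge0 ?gain_ge0. Qed.

Let stage_le i pi sigma n : stage i pi sigma n <= gain_bound * beta ^+ n.
Proof.
apply: (@le_trans _ _ (gain_bound * \sum_(x : K * history S A B n * A * B) weight i pi sigma x)).
  rewrite mulr_sumr; apply: ler_sum => x _; rewrite mulrC ler_wpM2r ?weight_ge0//.
  exact: gain_le.
apply: ler_wpM2l; first exact: gain_bound_ge0.
exact: (sum_weight_le Q_kernel alpha_gt0 p i pi sigma delta_gt0 epsilon_gt0 epsilon_lt1 D_le).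
Qed.

(* [partial_payoff M + tail_bound * beta ^+ M] is nonincreasing in [M]. *)
Let partial_tail i pi sigma N M :
  partial_payoff i pi sigma M <= partial_payoff i pi sigma N + tail_bound * beta ^+ N.
Proof.
have D0 n : 0 <= tail_bound * beta ^+ n.
  apply: mulr_ge0; last exact: exprn_ge0.
  by apply: divr_ge0; [exact: gain_bound_ge0|rewrite subr_ge0 ltW].
have SS n : partial_payoff i pi sigma n.+1 = partial_payoff i pi sigma n + stage i pi sigma n.
  by rewrite /partial_payoff big_ord_recr.
have [MN|/ltnW NM] := leqP M N.
  rewrite -[leLHS]addr0 lerD//.
  move: MN => /subnK <-; elim: (N - M)%N => [|m IH] //.
  by rewrite addSn SS (le_trans IH)// lerDl stage_ge0.
suff : partial_payoff i pi sigma M + tail_bound * beta ^+ M <=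
    partial_payoff i pi sigma N + tail_bound * beta ^+ N.
  by apply: le_trans; rewrite lerDl.
move: NM => /subnK <-; elim: (M - N)%N => [|m IH] //.
apply: le_trans IH; rewrite addSn SS exprS -addrA lerD2l.
apply: (le_trans (lerD (stage_le i pi sigma (m + N)) (lexx _))).
have -> : gain_bound = tail_bound * (1 - beta).
  by rewrite /tail_bound divfK// subr_eq0 gt_eqF.
by rewrite le_eqVlt; apply/orP; left; apply/eqP; ring.
Qed.

Lemma payoff_bounds i pi sigma N :
  ((partial_payoff i pi sigma N)%:E <= payoff Q c alpha p i pi sigma /\
   payoff Q c alpha p i pi sigma <=
     (partial_payoff i pi sigma N + tail_bound * beta ^+ N)%:E)%E.
Proof.
rewrite (payoffE Q_kernel c_ge0 alpha_gt0 p i pi sigma).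
have s0 n : (0 <= (stage i pi sigma n)%:E)%E by rewrite lee_fin stage_ge0.
have psE M : (\sum_(0 <= n < M) (stage i pi sigma n)%:E =
    (partial_payoff i pi sigma M)%:E)%E by rewrite sumEFin big_mkord.
split.
  by rewrite -psE; apply: nneseries_lim_ge => n _ _; exact: s0.
apply: lime_le; first by apply: is_cvg_nneseries => n _ _; exact: s0.
by near=> M; rewrite psE lee_fin; exact: partial_tail.
Unshelve. all: by end_near. Qed.

Lemma mass_lawS i pi sigma n k (h : history S A B n) a b j :
  mass_law i pi sigma k (history_ext h a b j) =
  disc_kernel Q alpha_gt0 j h.2 a b *
    (pi k n h a * sigma n h b * mass_law i pi sigma k h).
Proof. exact: (massS Q_kernel alpha_gt0 (law_is_law Q_kernel p i pi sigma)). Qed.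

Lemma mass_law0 i pi sigma k (h : history S A B 0) :
  mass_law i pi sigma k h = if h.2 == i then p k else 0.
Proof. exact: (mass0 alpha_gt0 (law_is_law Q_kernel p i pi sigma)). Qed.

Lemma mass_law_first i pi sigma n k (h : history S A B n) :
  first_state h != i -> mass_law i pi sigma k h = 0.
Proof.
elim: n h => [|n IH] h; first by rewrite first_state0 mass_law0 => /negbTE ->.
have [h0 [a [b [j ->]]]] := history_ext_surj h.
by rewrite first_state_ext mass_lawS => /IH ->; rewrite !mulr0.
Qed.

(** Histories that start elsewhere have mass 0, so what a policy prescribes there does not affect
    the payoff from i. *)
Lemma payoff_agree i (pi pi' : policy1) sigma :
  (forall k n (h : history S A B n), first_state h = i -> pi k n h = pi' k n h) ->
  payoff Q c alpha p i pi sigma = payoff Q c alpha p i pi' sigma.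
Proof.
move=> ag.
have mE n k (h : history S A B n) : mass_law i pi sigma k h = mass_law i pi' sigma k h.
  elim: n h => [|n IH] h; first by rewrite !mass_law0.
  have [h0 [a [b [j ->]]]] := history_ext_surj h.
  rewrite !mass_lawS IH; have [hi|hi] := eqVneq (first_state h0) i; first by rewrite ag.
  by rewrite mass_law_first// !mulr0.
have wE n (x : K * history S A B n * A * B) : weight i pi sigma x = weight i pi' sigma x.
  rewrite /weight -[mass _ _ _ _]/(mass_law i pi sigma x.1.1.1 x.1.1.2).
  rewrite -[in RHS]/(mass_law i pi' sigma x.1.1.1 x.1.1.2) mE.
  have [hi|hi] := eqVneq (first_state x.1.1.2) i; first by rewrite ag.
  by rewrite mass_law_first// !mulr0.
rewrite !(payoffE Q_kernel c_ge0 alpha_gt0); apply: eq_eseriesr => n _.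
apply: (congr1 EFin); apply: eq_bigr => x _.
by rewrite wE.
Qed.

Definition dirac_fdist (E : finPointedType) : fdist R E.
Proof.
apply: (@FDist R E (fun x => (x == point)%:R)) => [x|]; first by case: (x == point).
by rewrite (bigD1 point)//= eqxx big1 ?addr0// => x /negbTE ->.
Defined.

(** Convergence in the product topology, stated coordinate by coordinate so that no topology on
    [policy1] is needed. *)
Definition policy_cvg (F : set_system policy1) (pi' : policy1) :=
  forall k n (h : history S A B n) a,
    (fun pi : policy1 => pi k n h a : R) @ F --> (pi' k n h a : R).

(** Nonnegativity and a finite sum equal to 1 survive the limit, so the coordinatewise limits are
    again distributions. *)
Lemma ultralimit_policy (F : set_system policy1) : UltraFilter F ->
  exists pi', policy_cvg F pi'.
Proof.
move=> FU.
have le1 (pi : policy1) k n (h : history S A B n) a : 0 <= pi k n h a <= 1.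
  rewrite fdist_ge0/= -(fdist_sum1 (pi k n h)) (bigD1 a)//= lerDl.
  by apply: sumr_ge0 => *; exact: fdist_ge0.
pose l k n (h : history S A B n) a : R := lim ((fun pi : policy1 => pi k n h a : R) @ F).
have cv k n (h : history S A B n) a :
    (fun pi : policy1 => pi k n h a : R) @ F --> l k n h a.
  exact: (@ultra_cvg01 R policy1 F (fun pi => pi k n h a) FU).
have l_ge0 k n (h : history S A B n) a : 0 <= l k n h a.
  apply: (cvgr_to_ge (@cv k n h a)).
  by apply: filterE => pi; exact: fdist_ge0.
have l_sum1 k n (h : history S A B n) : \sum_a l k n h a = 1.
  have FF : Filter F by exact: _.
  have := @cvg_sum R policy1 F A (index_enum A) _ _ FF (@cv k n h).
  under eq_fun do rewrite fdist_sum1.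
  move=> /cvg_lim <-//; apply/cvg_lim => //; exact: cvg_cst.
by exists (fun k n h => FDist (l_ge0 k n h) (l_sum1 k n h)).
Qed.

Lemma cvg_partial_payoff (F : set_system policy1) (pi' : policy1) i sigma N :
  Filter F -> policy_cvg F pi' ->
  (fun pi => partial_payoff i pi sigma N) @ F --> partial_payoff i pi' sigma N.
Proof.
move=> FF cv.
have mcv n k (h : history S A B n) :
    (fun pi => mass_law i pi sigma k h) @ F --> mass_law i pi' sigma k h.
  elim: n h => [|n IH] h.
    rewrite mass_law0; under eq_fun do rewrite mass_law0.
    exact: cvg_cst.
  have [h0 [a [b [j ->]]]] := history_ext_surj h.
  rewrite mass_lawS; under eq_fun do rewrite mass_lawS.
  apply: cvgMr; apply: cvgM; last exact: IH.
  by apply: cvgMl; exact: cv.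
apply: cvg_sum => n; apply: cvg_sum => x.
apply: cvgMl; apply: cvgM; last exact: mcv.
by apply: cvgMl; exact: cv.
Qed.

Lemma optimal_from i : exists pi' : policy1, forall sigma,
  (lower_value Q c alpha p i <= payoff Q c alpha p i pi' sigma)%E.
Proof.
set L := lower_value Q c alpha p i.
have L_ge0 : (0 <= L)%E.
  pose pi0 : policy1 := fun _ _ _ => dirac_fdist A.
  apply: (@le_trans _ _ (guarantee1 Q c alpha p i pi0)).
    apply: le_ereal_inf_tmp => _ [sigma _ <-].
    by have [+ _] := payoff_bounds i pi0 sigma 0; rewrite /partial_payoff big_ord0.
  by apply: ereal_sup_ubound; exists pi0.
(* Finiteness guarantees that some policy secures more than L - e for each e > 0. *)
have L_fin : L \is a fin_num.
  rewrite ge0_fin_numE//; apply: (@le_lt_trans _ _ tail_bound%:E); last exact: ltry.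
  apply: ge_ereal_sup => _ [pi _ <-].
  pose sigma0 : policy2 := fun _ _ => dirac_fdist B.
  apply: (@le_trans _ _ (payoff Q c alpha p i pi sigma0)).
    by apply: ereal_inf_lbound; exists sigma0.
  have [_] := payoff_bounds i pi sigma0 0.
  by rewrite /partial_payoff big_ord0 add0r expr0 mulr1.
(* These nested nonempty sets generate a proper filter; an ultrafilter refining it stands in for a
   maximizing sequence with convergent coordinates. *)
pose near_optimal (e : R) := [set pi : policy1 | (L - e%:E < guarantee1 Q c alpha p i pi)%E].
have F0 : ProperFilter (filter_from [set e : R | 0 < e] near_optimal).
  apply: filter_from_proper.
    apply: filter_from_filter; first by exists 1 => /=.
    move=> e e' /= e0 e'0; exists (Num.min e e'); first by rewrite /= lt_min e0.
    move=> pi; rewrite /near_optimal /= => h; split; apply: le_lt_trans h.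
      by rewrite leeD2l// lee_fin lerN2 ge_min lexx.
    by rewrite leeD2l// lee_fin lerN2 ge_min lexx orbT.
  move=> e /= e0; have [_ [pi _ <-] h] := ub_ereal_sup_adherent e0 L_fin.
  by exists pi.
have [U [UU F0U]] := ultraFilterLemma F0.
have [pi' cv] := ultralimit_policy UU.
exists pi' => sigma.
rewrite -(fineK L_fin).
(* For near-optimal [pi] the inequality follows from the upper half of [payoff_bounds]; with N fixed
   it passes to the limit along U. Afterwards N tends to infinity and the tail vanishes. *)
have key N (e : R) : 0 < e -> fine L - e <= partial_payoff i pi' sigma N + tail_bound * beta ^+ N.
  move=> e0; rewrite -lerBlDr.
  apply: (cvgr_to_ge (@cvg_partial_payoff U pi' i sigma N _ cv)).
  apply: F0U; exists e => //= pi; rewrite /near_optimal /= => h.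
  rewrite lerBlDr -lee_fin EFinB fineK//.
  apply: le_trans (ltW h) _; have [_] := payoff_bounds i pi sigma N; apply: le_trans.
  by apply: ereal_inf_lbound; exists sigma.
have bcv : (fun N => tail_bound * beta ^+ N) @ \oo --> (0 : R).
  rewrite -[X in _ --> X](mulr0 tail_bound); apply: cvgMr.
  by apply: cvg_expr; rewrite ger0_norm.
have [lo' up'] := payoff_bounds i pi' sigma 0.
have pfin : payoff Q c alpha p i pi' sigma \is a fin_num.
  rewrite ge0_fin_numE; first by apply: le_lt_trans up' _; exact: ltry.
  by apply: le_trans lo'; rewrite /partial_payoff big_ord0.
rewrite -(fineK pfin) lee_fin; apply/ler_addgt0Pl => e e0; rewrite -lerBlDl.
rewrite -[leRHS]addr0.
have c2 : (fun N => fine (payoff Q c alpha p i pi' sigma) + tail_bound * beta ^+ N) @ \oo -->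
    fine (payoff Q c alpha p i pi' sigma) + 0 by apply: cvgD => //; exact: cvg_cst.
apply: (cvgr_to_ge c2); near=> N.
apply: le_trans (key N e e0) _; rewrite lerD2r -lee_fin fineK//.
by have [] := payoff_bounds i pi' sigma N.
Unshelve. all: by end_near. Qed.

Lemma optimal_policy : exists pi : policy1, forall i sigma,
  (lower_value Q c alpha p i <= payoff Q c alpha p i pi sigma)%E.
Proof.
have [f Hf] := choice optimal_from.
exists (fun k n h => f (first_state h) k n h) => i sigma.
rewrite (@payoff_agree i _ (f i))//.
by move=> k n h ->.
Qed.

End optimality.

Theorem theorem4p1 (R : realType) (K S A B : finPointedType)
  (Q : R -> S -> S -> A -> B -> R) (c : K -> S -> A -> B -> R) (alpha : R)
  (Q_kernel : semi_markov_kernel Q)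
  (c_ge0 : forall k i a b, 0 <= c k i a b)
  (alpha_gt0 : 0 < alpha)
  (delta epsilon : R) (delta_gt0 : 0 < delta)
  (epsilon_gt0 : 0 < epsilon) (epsilon_lt1 : epsilon < 1)
  (D_le : forall i a b, sojourn_cdf Q delta i a b <= 1 - epsilon)
  (p : fdist R K) :
  exists pi : policy1 R K S A B,
    (forall (i : S) (v : \bar R), is_value Q c alpha p i v ->
       forall sigma : policy2 R S A B, (v <= payoff Q c alpha p i pi sigma)%E)
    /\ optimal1 Q c alpha p pi.
Proof.
have [pi Hpi] := optimal_policy Q_kernel c_ge0 alpha_gt0 delta_gt0 epsilon_gt0
  epsilon_lt1 D_le p.
exists pi; split; first by move=> i v [<- _] sigma.
by move=> i; apply: le_ereal_inf_tmp => _ [sigma _ <-].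
Qed.
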